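(* Let $\kappa>0$, let $\zeta\in L^\infty(\Gamma_{\rm I})$ be complex-valued with $\operatorname{Re}\zeta\ge 0$, and let $\delta_\zeta>0$ be such that $|\zeta|\ge\delta_\zeta$ almost everywhere on $\Gamma_{\rm I}^-$. Let $C_I>0$ be a constant, independent of $h$, such that the inverse inequality $$\int_{\Gamma_{\rm I}} h\,\Bigl|\Bigl\{\frac{\partial p_h}{\partial n}\Bigr\}\Bigr|^2\le C_I\int_{\Omega_1\cup\Omega_2}|\nabla p_h|^2\qquad\forall p_h\in V_h$$ holds, let $\gamma\ge 16\,C_I$, and let $$\lambda=\Bigl(\frac h\gamma+\frac{\zeta}{\mathrm i\kappa}\Bigr)^{-1}.$$ Let $h_0=+\infty$ if $|\Gamma_{\rm I}^-|=0$ and $h_0=\gamma\delta_\zeta/(4\kappa)$ if $|\Gamma_{\rm I}^-|>0$. Then for every mesh size $0<h\le h_0$ (with $h<\infty$), $$|a_\lambda(p_h,\overline{p}_h)|+2\kappa\Bigl(\kappa\int_{\Omega_1\cup\Omega_2}|p_h|^2+\frac1{\delta_\zeta}\int_{\Gamma_{\rm I}^-}\bigl|[\![p_h]\!]\bigr|^2\Bigr)\ \ge\ \frac14\,|||p_h|||^2\qquad\forall p_h\in V_h .$$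
   Context: Geometry. $\Omega\subset\mathbb R^3$ is an open bounded domain with polyhedral Lipschitz boundary, split into two disjoint, open, connected subdomains $\Omega_1,\Omega_2$ with $\Omega=\Omega_1\cup\Omega_2\cup\Gamma_{\rm I}$, where $\Gamma_{\rm I}=\overline\Omega_1\cap\overline\Omega_2$ is a smooth interface of codimension one with positive measure. The boundary of $\Omega_1\cup\Omega_2$ consists of the non-overlapping parts $\Gamma_{\rm I}$, $\Gamma_{\rm io}$, $\Gamma_{\rm s}$. $|\Gamma|$ denotes surface measure. $\Gamma_{\rm I}^-$ is the subset of $\Gamma_{\rm I}$ on which $\operatorname{Im}\zeta<0$ (defined up to null sets). Spaces. $H^m(\Omega_1\cup\Omega_2)$ is the complex ''broken'' Sobolev space of functions whose restriction to each $\Omega_i$ is in $H^m(\Omega_i)$; its elements may be discontinuous across $\Gamma_{\rm I}$. Traces. $\boldsymbol n_i$ is the outward unit normal of $\Omega_i$ on $\Gamma_{\rm I}$ ($\boldsymbol n_2=-\boldsymbol n_1$), $\boldsymbol n$ is a fixed choice of one of these, $p_i$ is the trace on $\Gamma_{\rm I}$ of $p|_{\Omega_i}$, $[\![p]\!]=\boldsymbol n\cdot(\boldsymbol n_1p_1+\boldsymbol n_2p_2)$, and $\{\partial p/\partial n\}=\frac12(\partial p_1/\partial n+\partial p_2/\partial n)$. Meshes. For $i=1,2$, $\{\mathcal T_i^h\}_{h>0}$ is a family of tetrahedral triangulations of $\Omega_i$, non-degenerate ($h_K/\rho_K\le C$ for all elements $K$ and all $h$, where $h_K$ is the diameter of $K$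 and $\rho_K$ the diameter of the largest ball in $K$) and quasi-uniform, with $h=\max_{K\in\mathcal T_1^h\cup\mathcal T_2^h}h_K$; the two meshes need not match on $\Gamma_{\rm I}$. For fixed $k\ge1$, $V_h=V_1^h+V_2^h$, where $V_i^h$ is the set of $v\in H^1(\Omega_1\cup\Omega_2)$ with $v|_K\in P_k(K)$ (complex polynomials of degree at most $k$) for all $K\in\mathcal T_i^h$ and $v\equiv0$ outside $\Omega_i$. Bilinear forms (no complex conjugation): $$a_0(p,q)=\int_{\Omega_1\cup\Omega_2}\nabla p\cdot\nabla q-\kappa^2\int_{\Omega_1\cup\Omega_2}pq+\mathrm i\kappa\int_{\Gamma_{\rm io}}pq,$$ $$\begin{aligned}a_\lambda(p,q)=a_0(p,q)&-\int_{\Gamma_{\rm I}}\Bigl\{\frac{\partial p}{\partial n}\Bigr\}\Bigl([\![q]\!]+\frac{\zeta}{\mathrm i\kappa}\Bigl\{\frac{\partial q}{\partial n}\Bigr\}\Bigr)-\int_{\Gamma_{\rm I}}\Bigl([\![p]\!]+\frac{\zeta}{\mathrm i\kappa}\Bigl\{\frac{\partial p}{\partial n}\Bigr\}\Bigr)\Bigl\{\frac{\partial q}{\partial n}\Bigr\}\\&+\int_{\Gamma_{\rm I}}\frac{\zeta}{\mathrm i\kappa}\Bigl\{\frac{\partial p}{\partial n}\Bigr\}\Bigl\{\frac{\partial q}{\partial n}\Bigr\}+\int_{\Gamma_{\rm I}}\lambda\Bigl([\![p]\!]+\frac{\zeta}{\mathrm i\kappa}\Bigl\{\frac{\partial p}{\partial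 n}\Bigr\}\Bigr)\Bigl([\![q]\!]+\frac{\zeta}{\mathrm i\kappa}\Bigl\{\frac{\partial q}{\partial n}\Bigr\}\Bigr).\end{aligned}$$ Norm: $$|||p|||^2=\int_{\Omega_1\cup\Omega_2}|\nabla p|^2+\kappa^2\int_{\Omega_1\cup\Omega_2}|p|^2+\frac1\gamma\int_{\Gamma_{\rm I}}h\Bigl|\Bigl\{\frac{\partial p}{\partial n}\Bigr\}\Bigr|^2+\int_{\Gamma_{\rm I}}|\lambda|\,\bigl|[\![p]\!]\bigr|^2 .$$ *)

(* Defs.v *)
From HB Require Import structures.
From mathcomp Require Import all_boot all_order all_algebra finmap.
From mathcomp Require Import all_classical all_reals all_analysis.
From mathcomp Require Import complex.
From mathcomp Require mpoly.

Set Implicit Arguments.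
Unset Strict Implicit.
Unset Printing Implicit Defensive.
Import Order.TTheory GRing.Theory Num.Theory.
Import numFieldNormedType.Exports.
Local Open Scope classical_set_scope.
Local Open Scope ring_scope.
Local Open Scope complex_scope.

Notation R3 R := (R * R * R)%type.

Section Euclidean.
Variable R : realType.
Implicit Types (x y c : R3 R) (A : set (R3 R)).

Definition coord x (i : 'I_3) : R := [:: x.1.1; x.1.2; x.2]`_i.

Definition basis_vec (i : 'I_3) : R3 R :=
  ((i == 0%N :> nat)%:R, (i == 1%N :> nat)%:R, (i == 2%N :> nat)%:R).

Definition dot x y : R := \sum_i coord x i * coord y i.

(* The library norm [`|x|] on a product type is the sup norm, hence enorm. *)
Definition enorm x : R := Num.sqrt (dot x x).

Definition eball c (r : R) : set (R3 R) := [set x | enorm (x - c) < r].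

Definition bdry A : set (R3 R) := closure A `\` A°.

(* The value 0 is added so that the empty set has diameter 0 and not -oo. *)
Definition ediam A : \bar R :=
  ereal_sup (0%E |` [set (enorm (xy.1 - xy.2))%:E | xy in A `*` A]).

Definition diam A : R := fine (ediam A).

Definition cabs (z : R[i]) : R := Normc.normc z.

Definition vol : {measure set (R3 (measurableTypeR R)) -> \bar R} :=
  (@lebesgue_measure R \x @lebesgue_measure R \x @lebesgue_measure R)%E.

End Euclidean.

(** Surface measure is the two-dimensional Hausdorff measure, normalized so that
    it is the area on planes.  The coverings in its definition are by arbitrary
    sets, so [mu_ext] is used with the sigma-algebra of all sets; the weight +oo
    excludes the covering sets of diameter greater than [e]. *)

Definition all_sets (R : realType) : Type := R3 R.

HB.instance Definition _ (R : realType) := Pointed.on (all_sets R).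
HB.instance Definition _ (R : realType) :=
  @isMeasurable.Build default_measure_display (all_sets R) discrete_measurable
    discrete_measurable0 discrete_measurableC discrete_measurableU.

Section SurfaceMeasure.
Variable R : realType.
Local Open Scope ereal_scope.

Definition gauge (e : R) (A : set (all_sets R)) : \bar R :=
  if ediam A <= e%:E then (pi / 4)%:E * ediam A ^+ 2 else +oo.

Definition hausdorff2 (A : set (R3 R)) : \bar R :=
  ereal_sup [set mu_ext (gauge e) A | e in [set e : R | (0 < e)%R]].

Lemma ediam_ge0 (A : set (R3 R)) : 0 <= ediam A.
Proof. by apply: ereal_sup_ubound; left. Qed.

Lemma ediam0 : ediam (set0 : set (R3 R)) = 0.
Proof. by rewrite /ediam set0X image_set0 setU0 ereal_sup1. Qed.

Lemma gauge_ge0 e (A : set (all_sets R)) : 0 <= gauge e A.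
Proof.
rewrite /gauge; case: ifP => // _; apply: mule_ge0; last first.
  by apply: expe_ge0; exact: ediam_ge0.
by rewrite lee_fin divr_ge0 // pi_ge0.
Qed.

Lemma gauge0 e : (0 < e)%R -> gauge e set0 = 0.
Proof.
move=> e0; rewrite /gauge ediam0 lee_fin ltW // expe2 mule0.
by rewrite ?mule0.
Qed.

Lemma hausdorff2_0 : hausdorff2 set0 = 0.
Proof.
rewrite /hausdorff2 (_ : [set _ | _ in _] = [set 0]) ?ereal_sup1 //.
apply/seteqP; split => [_ [e /= e0 <-]|_ ->].
  by rewrite mu_ext0 //; [exact: gauge0|exact: gauge_ge0].
by exists 1%R => //=; rewrite mu_ext0 //; [exact: gauge0|exact: gauge_ge0].
Qed.

Lemma mu_ext_le_hausdorff2 e A :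
  (0 < e)%R -> mu_ext (gauge e) A <= hausdorff2 A.
Proof. by move=> e0; apply: ereal_sup_ubound; exists e. Qed.

Lemma hausdorff2_ge0 A : 0 <= hausdorff2 A.
Proof.
apply: le_trans (mu_ext_le_hausdorff2 A ltr01).
by apply: mu_ext_ge0; exact: gauge_ge0.
Qed.

Lemma le_hausdorff2 : {homo hausdorff2 : A B / A `<=` B >-> A <= B}.
Proof.
move=> A B AB; apply: ge_ereal_sup => _ [e /= e0 <-].
by apply: le_trans (mu_ext_le_hausdorff2 B e0); exact: le_mu_ext.
Qed.

Lemma hausdorff2_sigma_subadditive : sigma_subadditive hausdorff2.
Proof.
move=> A; apply: ge_ereal_sup => _ [e /= e0 <-].
apply: le_trans (mu_ext_sigma_subadditive (gauge_ge0 e) _) _.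
apply: lee_nneseries => [i _ _|i _]; last exact: mu_ext_le_hausdorff2.
by apply: mu_ext_ge0; exact: gauge_ge0.
Qed.

HB.instance Definition _ := isOuterMeasure.Build R (R3 R) hausdorff2
  hausdorff2_0 hausdorff2_ge0 le_hausdorff2 hausdorff2_sigma_subadditive.

Definition surf : set (caratheodory_type hausdorff2) -> \bar R := hausdorff2.

HB.instance Definition _ := isMeasure.Build _ _ _ surf
  (@caratheodory_measure0 _ _ hausdorff2)
  (@caratheodory_measure_ge0 _ _ hausdorff2)
  (@caratheodory_measure_sigma_additive _ _ hausdorff2).

End SurfaceMeasure.
Arguments surf {R}.
Arguments vol {R}.

Section ComplexIntegral.
Context {R : realType} {d : measure_display} {T : measurableType d}.
Variable mu : {measure set T -> \bar R}.
Implicit Types (D : set T) (f : T -> R[i]).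

Definition cmeasurable_fun D f : Prop :=
  measurable_fun D (fun x => complex.Re (f x)) /\
  measurable_fun D (fun x => complex.Im (f x)).

Definition cintegral D f : R[i] :=
  (\int[mu]_(x in D) complex.Re (f x)) +i* (\int[mu]_(x in D) complex.Im (f x)).

Definition L2 D f : Prop :=
  cmeasurable_fun D f /\ (\int[mu]_(x in D) (cabs (f x) ^+ 2)%:E < +oo)%E.

Definition L2_cvg D (F : nat -> T -> R[i]) f : Prop :=
  (fun n => \int[mu]_(x in D) (cabs (F n x - f x) ^+ 2)%:E)%E @ \oo --> 0%E.

Definition Linfty D f : Prop :=
  cmeasurable_fun D f /\
  exists M : R, {ae mu, forall x, D x -> cabs (f x) <= M}.

End ComplexIntegral.

Section Sobolev.
Variable R : realType.
Implicit Types (D G : set (R3 R)) (f : R3 R -> R) (u t : R3 R -> R[i]).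
Implicit Types (g : 'I_3 -> R3 R -> R[i]) (x : R3 R).

Definition pderiv (j : 'I_3) f : R3 R -> R := fun x => 'D_(basis_vec R j) f x.

Definition grad f x : R3 R :=
  (pderiv (inord 0) f x, pderiv (inord 1) f x, pderiv (inord 2) f x).

Definition smooth f : Prop := forall s : seq 'I_3,
  continuous (foldr pderiv f s) /\
  forall j x, derivable (foldr pderiv f s) x (basis_vec R j).

Definition csmooth u : Prop :=
  smooth (fun x => complex.Re (u x)) /\ smooth (fun x => complex.Im (u x)).

Definition cpderiv (j : 'I_3) u : R3 R -> R[i] := fun x =>
  pderiv j (fun y => complex.Re (u y)) x +i*
  pderiv j (fun y => complex.Im (u y)) x.

Definition test_fun D f : Prop :=
  let S := closure [set x | f x != 0] in [/\ smooth f, compact S & S `<=` D].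

Definition weak_grad D u g : Prop := forall f, test_fun D f -> forall j,
  cintegral vol D (fun x => u x * (pderiv j f x)%:C) =
  - cintegral vol D (fun x => g j x * (f x)%:C).

Definition H1_grad D u g : Prop :=
  [/\ L2 vol D u, forall j, L2 vol D (g j) & weak_grad D u g].

Definition H1 D u : Prop := exists g, H1_grad D u g.

(* [t] is the Sobolev trace of u|_D on the part [G] of the boundary of [D]: the
   L2(G) limit of the values of smooth functions that tend to [u] in H1(D). *)
Definition is_trace D G u t : Prop :=
  exists g (F : nat -> R3 R -> R[i]),
    H1_grad D u g /\ L2 surf G t /\ (forall n, csmooth (F n)) /\
    L2_cvg vol D F u /\
    (forall j, L2_cvg vol D (fun n => cpderiv j (F n)) (g j)) /\
    L2_cvg surf G F t.

End Sobolev.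

Section Geometry.
Variable R : realType.
Implicit Types (V K : {fset R3 R}) (D U W Gio Gs : set (R3 R)).

Definition hull V : set (R3 R) :=
  [set x | exists t : R3 R -> R, [/\ forall v, v \in V -> 0 <= t v,
     \sum_(v <- V) t v = 1 & x = \sum_(v <- V) t v *: v]].

Definition affinely_independent V : Prop := forall t : R3 R -> R,
  \sum_(v <- V) t v = 0 -> \sum_(v <- V) t v *: v = 0 ->
  forall v, v \in V -> t v = 0.

Definition simplex_vertices (n : nat) V : Prop :=
  #|` V| = n /\ affinely_independent V.

Definition polyhedral_boundary D : Prop :=
  exists F : {fset {fset R3 R}},
    (forall V, V \in F -> simplex_vertices 3 V) /\
    bdry D = \bigcup_(V in [set` F]) hull V.

Definition lipschitz_boundary D : Prop := forall x, bdry D x ->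
  exists (b : 'I_3 -> R3 R) (f : R -> R -> R) (L r : R),
    [/\ 0 < r, forall i j, dot (b i) (b j) = (i == j)%:R,
        forall s1 t1 s2 t2,
          `|f s1 t1 - f s2 t2| <= L * (`|s1 - s2| + `|t1 - t2|) &
        forall y, eball x r y ->
          (D y <-> f (dot y (b (inord 0))) (dot y (b (inord 1)))
                   < dot y (b (inord 2)))].

Definition interface W1 W2 : set (R3 R) := closure W1 `&` closure W2.

(* The hypersurface [phi = 0] is the interface inside [U], with [W1] on the
   negative side and [W2] on the positive side. *)
Definition local_equation W1 W2 U (phi : R3 R -> R) : Prop :=
  smooth phi /\ forall y, U y ->
    [/\ grad phi y != 0, W1 y <-> phi y < 0, W2 y <-> 0 < phi y
      & interface W1 W2 y <-> phi y = 0].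

(* The interface is closed and may meet the boundary of [W], so the splitting
   of the open set [W] involves its part inside [W] only. *)
Record split_domain W W1 W2 Gio Gs : Prop := SplitDomain {
  sd_open : open W;
  sd_connected : connected W;
  sd_bounded : bounded_set W;
  sd_polyhedral : polyhedral_boundary W;
  sd_lipschitz : lipschitz_boundary W;
  sd_open1 : open W1;
  sd_open2 : open W2;
  sd_connected1 : connected W1;
  sd_connected2 : connected W2;
  sd_disjoint : W1 `&` W2 = set0;
  sd_union : W = W1 `|` W2 `|` (interface W1 W2 `&` W);
  sd_interface_in : surf (interface W1 W2 `\` W) = 0%E;
  sd_interface_smooth : forall x, (interface W1 W2 `&` W) x ->
    exists U phi, [/\ open U, U x & local_equation W1 W2 U phi];
  sd_interface_pos : (0 < surf (interface W1 W2))%E;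
  sd_measurable_io : (@hausdorff2 R).-cara.-measurable Gio;
  sd_measurable_s : (@hausdorff2 R).-cara.-measurable Gs;
  sd_boundary : bdry (W1 `|` W2) = interface W1 W2 `|` Gio `|` Gs;
  sd_I_io : surf (interface W1 W2 `&` Gio) = 0%E;
  sd_I_s : surf (interface W1 W2 `&` Gs) = 0%E;
  sd_io_s : surf (Gio `&` Gs) = 0%E
}.

(* On the side of [W1] the function [phi] is negative, so its normalized
   gradient is the outward unit normal of [W1]. *)
Definition outward_normal W1 W2 (n1 : R3 R -> R3 R) : Prop :=
  forall U phi, open U -> local_equation W1 W2 U phi ->
  forall x, U x -> interface W1 W2 x ->
    n1 x = (enorm (grad phi x))^-1 *: grad phi x.

(* A tetrahedron is given by its set of vertices.  Two elements meet in the hull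
   of their common vertices: a common face, edge or vertex, or nothing. *)
Definition triangulation D (T : {fset {fset R3 R}}) : Prop :=
  [/\ forall K, K \in T -> simplex_vertices 4 K,
      closure D = \bigcup_(K in [set` T]) hull K &
      forall K K', K \in T -> K' \in T ->
        hull K `&` hull K' = hull (K `&` K')%fset].

Definition elt_diam K : R := diam (hull K).

Definition elt_inner_diam K : R :=
  sup [set 2 * r | r in [set r : R | 0 < r /\
    exists c, eball c r `<=` hull K]].

Definition mesh_size (T1 T2 : {fset {fset R3 R}}) : R :=
  \big[Num.max/0]_(K <- (T1 `|` T2)%fset) elt_diam K.

Definition non_degenerate (H : set R) (T : R -> {fset {fset R3 R}}) : Prop :=
  exists C : R, forall h, H h -> forall K, K \in T h ->
    elt_diam K / elt_inner_diam K <= C.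

Definition quasi_uniform (H : set R) (T : R -> {fset {fset R3 R}}) : Prop :=
  exists c : R, 0 < c /\ forall h, H h -> forall K, K \in T h ->
    c * h <= elt_diam K.

(* The family is indexed by the set [H] of its mesh sizes (not every h > 0 can be
   the mesh size of a triangulation of a bounded domain). *)
Definition mesh_families W1 W2 (H : set R) (T1 T2 : R -> {fset {fset R3 R}}) :
    Prop :=
  (forall h, H h -> [/\ 0 < h, triangulation W1 (T1 h),
     triangulation W2 (T2 h) & h = mesh_size (T1 h) (T2 h)]) /\
  [/\ non_degenerate H T1, non_degenerate H T2,
      quasi_uniform H T1 & quasi_uniform H T2].

End Geometry.

Section DiscreteSpace.
Variable R : realType.
Implicit Types (W : set (R3 R)) (T : {fset {fset R3 R}}).
Implicit Types (v : R3 R -> R[i]) (n : R3 R -> R3 R) (k : nat).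

Definition poly_degree_le k (P : mpoly.mpoly 3 R[i]) : Prop :=
  forall m, (k < mpoly.mdeg m)%N -> mpoly.mcoeff m P = 0.

Definition poly_val (P : mpoly.mpoly 3 R[i]) (x : R3 R) : R[i] :=
  mpoly.meval (fun i => (coord x i)%:C) P.

Definition broken_H1 W1 W2 v : Prop := H1 W1 v /\ H1 W2 v.

(* V_i^h, with [Wi] one of [W1], [W2] and [T] its mesh; as for all elements of
   Sobolev spaces, functions stand for their classes modulo null sets. *)
Definition in_Vi k W1 W2 (Wi : set (R3 R)) T v : Prop :=
  [/\ broken_H1 W1 W2 v,
      forall K, K \in T -> exists2 P, poly_degree_le k P &
        {ae vol, forall x, hull K x -> v x = poly_val P x} &
      {ae vol, forall x, (W1 `|` W2) x -> ~ Wi x -> v x = 0}].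

Definition in_Vh k W1 W2 T1 T2 v : Prop := exists v1 v2,
  [/\ in_Vi k W1 W2 W1 T1 v1, in_Vi k W1 W2 W2 T2 v2 & v = v1 \+ v2].

(** A function p on W1 U W2 together with the objects derived from it that enter
    the forms: its broken gradient, its traces from the two sides and its one-sided
    normal derivatives on the interface.  By [dg_data] all of them are determined
    by p up to null sets. *)
Record dgfun := DGFun {
  dg_val : R3 R -> R[i];
  dg_grad : 'I_3 -> R3 R -> R[i];
  dg_tr1 : R3 R -> R[i];
  dg_tr2 : R3 R -> R[i];
  dg_dn1 : R3 R -> R[i];
  dg_dn2 : R3 R -> R[i] }.

Definition dg_conj (p : dgfun) : dgfun :=
  DGFun (fun x => conjc (dg_val p x)) (fun j x => conjc (dg_grad p j x))
    (fun x => conjc (dg_tr1 p x)) (fun x => conjc (dg_tr2 p x))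
    (fun x => conjc (dg_dn1 p x)) (fun x => conjc (dg_dn2 p x)).

(* Only on each element is the gradient [g] of a discrete function in H1, so its
   trace on the interface is taken element by element. *)
Definition is_normal_deriv W1 W2 T n (g : 'I_3 -> R3 R -> R[i])
    (q : R3 R -> R[i]) : Prop :=
  forall K, K \in T -> exists t : 'I_3 -> R3 R -> R[i],
    (forall j, is_trace (hull K)° (interface W1 W2 `&` hull K) (g j) (t j)) /\
    {ae surf, forall x, (interface W1 W2 `&` hull K) x ->
      q x = \sum_j (coord (n x) j)%:C * t j x}.

Definition dg_data W1 W2 T1 T2 n (p : dgfun) : Prop :=
  [/\ H1_grad (W1 `|` W2) (dg_val p) (dg_grad p),
      is_trace W1 (bdry W1) (dg_val p) (dg_tr1 p),
      is_trace W2 (bdry W2) (dg_val p) (dg_tr2 p),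
      is_normal_deriv W1 W2 T1 n (dg_grad p) (dg_dn1 p) &
      is_normal_deriv W1 W2 T2 n (dg_grad p) (dg_dn2 p)].

Definition Vh k W1 W2 T1 T2 n : set dgfun :=
  [set p | in_Vh k W1 W2 T1 T2 (dg_val p) /\ dg_data W1 W2 T1 T2 n p].

End DiscreteSpace.

Section Forms.
Variable R : realType.
Variables (W1 W2 Gio : set (R3 R)) (n1 n : R3 R -> R3 R) (kappa : R).
Implicit Types (p q : dgfun R) (zeta lam : R3 R -> R[i]).

Local Notation GI := (interface W1 W2).

Definition cdot (u v : 'I_3 -> R3 R -> R[i]) : R3 R -> R[i] :=
  fun x => \sum_j u j x * v j x.

Definition grad_sq_norm p : R :=
  \int[vol]_(x in W1 `|` W2) \sum_j cabs (dg_grad p j x) ^+ 2.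

Definition sq_norm p : R := \int[vol]_(x in W1 `|` W2) (cabs (dg_val p x) ^+ 2).

Definition jump p : R3 R -> R[i] := fun x =>
  \sum_j (coord (n x) j)%:C *
    ((coord (n1 x) j)%:C * dg_tr1 p x + (coord (- n1 x) j)%:C * dg_tr2 p x).

Definition avg_dn p : R3 R -> R[i] := fun x => (dg_dn1 p x + dg_dn2 p x) / 2.

(* On Gio the trace is the one from the subdomain whose boundary contains the
   point; the points of both boundaries lie in Gio and the interface, hence form
   a null set. *)
Definition a0 p q : R[i] :=
  cintegral vol (W1 `|` W2) (cdot (dg_grad p) (dg_grad q))
  - (kappa ^+ 2)%:C *
      cintegral vol (W1 `|` W2) (fun x => dg_val p x * dg_val q x)
  + 'i%C * kappa%:C *
      (cintegral surf (Gio `&` bdry W1) (fun x => dg_tr1 p x * dg_tr1 q x) +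
       cintegral surf (Gio `&` bdry W2) (fun x => dg_tr2 p x * dg_tr2 q x)).

Definition scaled_zeta zeta : R3 R -> R[i] :=
  fun x => zeta x / ('i%C * kappa%:C).

Definition robin_jump zeta p : R3 R -> R[i] :=
  fun x => jump p x + scaled_zeta zeta x * avg_dn p x.

Definition a_lam zeta lam p q : R[i] :=
  a0 p q
  - cintegral surf GI (fun x => avg_dn p x * robin_jump zeta q x)
  - cintegral surf GI (fun x => robin_jump zeta p x * avg_dn q x)
  + cintegral surf GI (fun x => scaled_zeta zeta x * avg_dn p x * avg_dn q x)
  + cintegral surf GI (fun x => lam x * robin_jump zeta p x * robin_jump zeta q x).

Definition dg_norm_sq (gamma h : R) lam p : R :=
  grad_sq_norm p + kappa ^+ 2 * sq_norm p
  + gamma^-1 * \int[surf]_(x in GI) (h * cabs (avg_dn p x) ^+ 2)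
  + \int[surf]_(x in GI) (cabs (lam x) * cabs (jump p x) ^+ 2).

Definition stab_lam (gamma h : R) zeta : R3 R -> R[i] :=
  fun x => ((h / gamma)%:C + scaled_zeta zeta x)^-1.

Definition interface_minus zeta : set (R3 R) :=
  [set x | GI x /\ complex.Im (zeta x) < 0].

Definition max_mesh_size (gamma delta : R) zeta : \bar R :=
  if surf (interface_minus zeta) == 0%E then +oo%E
  else (gamma * delta / (4 * kappa))%:E.

End Forms.

(* Main.v *)
Require Import Defs.
From mathcomp Require Import all_boot all_order all_algebra finmap.
From mathcomp Require Import all_classical all_reals all_analysis.
From mathcomp Require Import complex measurable_realfun ring lra.
Set Implicit Arguments.
Unset Strict Implicit.
Unset Printing Implicit Defensive.
Import Order.TTheory GRing.Theory Num.Theory.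
Import numFieldNormedType.Exports.
Local Open Scope classical_set_scope.
Local Open Scope ring_scope.

(** Testing with the conjugate and writing z = zeta / (i kappa), s = h / gamma,
    J and D for the jump and the mean normal derivative, the interface part of
    the form collapses to the integral of lambda |J - s D|^2 - s |D|^2.  Since
    |a| >= (Re a + Im a) / 2, it is enough to bound (Re lambda + Im lambda)
    |J - s D|^2 from below pointwise.  As Im z <= 0, Im lambda >= 0 everywhere.
    Where Im zeta >= 0, also Re lambda >= 0 and s |lambda| <= 1.  Where
    Im zeta < 0, the bound s <= delta / (4 kappa) gives |s + z| >= 3 delta /
    (4 kappa), and the additional jump term absorbs the sign of Re lambda.  The
    terms s |D|^2 are absorbed by the gradient through the inverse inequality.

    The integrals may be split only if J and D are square integrable on the
    interface, so closed sets have to be measurable for the surface measure: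
    the Hausdorff measure is a metric outer measure. *)

(** * Additivity of the Hausdorff measure on separated sets and measurability of closed sets *)

Section HausdorffMeasure.
Variable R : realType.
Implicit Types (A B C : set (R3 R)) (x y : R3 R).

Lemma dotE x y : dot x y = x.1.1 * y.1.1 + x.1.2 * y.1.2 + x.2 * y.2.
Proof. by rewrite /dot !big_ord_recl big_ord0 /coord /= addr0 addrA. Qed.

(** Separation is measured in the sup norm and diameters in the Euclidean norm; this comparison
    links the two. *)
Lemma norm_le_enorm x : `|x| <= enorm x.
Proof.
have le_sqrt (a b : R) : a ^+ 2 <= b -> `|a| <= Num.sqrt b.
  by move=> ab; rewrite -sqrtr_sqr ler_wsqrtr.
rewrite /enorm dotE !prod_normE /= !ge_max -andbA; apply/and3P; split.
all: apply: le_sqrt; rewrite -!expr2.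
all: by have := (sqr_ge0 x.1.1, sqr_ge0 x.1.2, sqr_ge0 x.2) => -[[? ?] ?]; lra.
Qed.

Local Open Scope ereal_scope.

Definition separated A B : Prop :=
  exists2 e : R, (0 < e)%R & forall x y, A x -> B y -> (e <= `|x - y|)%R.

Lemma ediam_lt_separated e A B (F : set (R3 R)) :
  (forall x y, A x -> B y -> (e <= `|x - y|)%R) -> ediam F < e%:E ->
  (F `&` A !=set0) -> F `&` B = set0.
Proof.
move=> sep Fe [x [Fx Ax]]; apply/eqP; rewrite -[_ == _]negbK; apply/negP.
move=> /set0P[y [Fy By]]; move: Fe; apply/negP; rewrite -leNgt.
apply: (@le_trans _ _ (enorm (x - y))%:E).
  by rewrite lee_fin (le_trans (sep _ _ Ax By)) ?norm_le_enorm.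
by apply: ereal_sup_ubound; right; exists (x, y).
Qed.

(** Decreasing [e] gives more covering sets the weight [+oo], so no covering gets cheaper. *)
Lemma mu_ext_gauge_antitone e e' A : (e <= e')%R ->
  mu_ext (gauge e') A <= mu_ext (gauge e) A.
Proof.
move=> ee'; apply: le_ereal_inf_tmp => _ [F [mF AF] <-].
apply: (@le_trans _ _ (\sum_(k <oo) gauge e' (F k))).
  by apply: ereal_inf_lbound; exists F.
apply: lee_nneseries => [k _ _|k _]; first exact: gauge_ge0.
rewrite /gauge; case: ifPn => [_|/negP Fe']; case: ifPn => // Fe.
  by rewrite leey.
by case: Fe'; rewrite (le_trans Fe) ?lee_fin.
Qed.

(** A covering set of diameter at most [e < e'] cannot meet both [A] and [B]. A covering of the
    union therefore splits into [FA], which covers [A], and [FB], which covers [B], at the same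
    total cost. *)
Lemma mu_ext_gauge_separated e e' A B : (0 < e < e')%R ->
  (forall x y, A x -> B y -> (e' <= `|x - y|)%R) ->
  mu_ext (gauge e) A + mu_ext (gauge e) B <= mu_ext (gauge e) (A `|` B).
Proof.
move=> /andP[e0 ee'] sep; apply: le_ereal_inf_tmp => _ [F [mF ABF] <-].
have g0 : gauge e set0 = 0 by exact: gauge0.
pose FA k := if `[< F k `&` A !=set0 >] then F k else set0.
pose FB k := if `[< F k `&` A !=set0 >] then set0 else F k.
have FAB k : gauge e (F k) = gauge e (FA k) + gauge e (FB k).
  by rewrite /FA /FB; case: ifP => _; rewrite g0 ?adde0 ?add0e.
(* A single covering set of diameter above [e] already costs [+oo], and then the inequality is
   trivial. *)
have [[k Fk]|small] := pselect (exists k, e%:E < ediam (F k)).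
  rewrite (@nneseriesD1 _ _ k) //; last by move=> *; exact: gauge_ge0.
  have -> : gauge e (F k) = +oo by rewrite /gauge leNgt Fk.
  rewrite addye ?leey// gt_eqF// (@lt_le_trans _ _ 0) ?ltNy0//.
  by apply: nneseries_ge0 => *; exact: gauge_ge0.
have {}small k : ediam (F k) < e'%:E.
  rewrite (@le_lt_trans _ _ e%:E) ?lte_fin// leNgt; apply/negP => Fk.
  by apply: small; exists k.
under eq_eseriesr do rewrite FAB.
rewrite nneseriesD; [|by move=> *; exact: gauge_ge0..].
apply: leeD; apply: ereal_inf_lbound; last first.
- exists FB => //; split => // y By.
  have [k _ Fky] := ABF y (or_intror By); exists k => //=.
  rewrite /FB; case: asboolP => // /(ediam_lt_separated sep (small k)) FB0.
  by have : (F k `&` B) y by []; rewrite FB0.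
- exists FA => //; split => // x Ax.
  have [k _ Fkx] := ABF x (or_introl Ax); exists k => //=.
  by rewrite /FA; case: asboolP => // -[]; exists x.
Qed.

(** The two suprema on the left may use different scales [u] and [v]. Both are lowered to a common
    scale [w], chosen below the separation constant [e]. *)
Lemma hausdorff2_separated A B : separated A B ->
  hausdorff2 A + hausdorff2 B <= hausdorff2 (A `|` B).
Proof.
move=> [e e0 sep]; set H := hausdorff2 (A `|` B).
have half (u v : R) : (0 < u)%R -> (0 < v)%R ->
    mu_ext (gauge u) A + mu_ext (gauge v) B <= H.
  move=> u0 v0; pose w := (Num.min (Num.min u v) (e / 2))%R.
  have w0 : (0 < w)%R by rewrite !lt_min u0 v0 divr_gt0.
  have we : (w < e)%R by rewrite gt_min; apply/orP; right; rewrite ltr_pdivrMr //; lra.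
  apply: le_trans (mu_ext_le_hausdorff2 _ w0).
  apply: le_trans (mu_ext_gauge_separated _ sep); last by rewrite w0.
  by apply: leeD; apply: mu_ext_gauge_antitone; rewrite /w !ge_min lexx ?orbT.
(* Outside the trivial infinite case all terms are finite, so one can be moved to the other side
   while the supremum over the scale of the other is taken. *)
have := leey H; rewrite le_eqVlt => /predU1P[->|Hoo]; first by rewrite leey.
have Hfin A' : A' `<=` A `|` B -> hausdorff2 A' \is a fin_num.
  move=> sub; rewrite ge0_fin_numE ?hausdorff2_ge0//.
  by apply: le_lt_trans Hoo; exact: le_hausdorff2.
have mfin u A' : (0 < u)%R -> A' `<=` A `|` B -> mu_ext (gauge u) A' \is a fin_num.
  move=> u0 sub; rewrite ge0_fin_numE ?mu_ext_ge0//; last exact: gauge_ge0.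
  apply: le_lt_trans (mu_ext_le_hausdorff2 _ u0) _.
  by apply: le_lt_trans Hoo; exact: le_hausdorff2.
rewrite -leeBrDr ?Hfin//; apply: ge_ereal_sup => _ [u /= u0 <-].
rewrite leeBrDr ?Hfin// addeC -leeBrDr ?mfin//.
apply: ge_ereal_sup => _ [v /= v0 <-].
by rewrite leeBrDr ?mfin// addeC; exact: half.
Qed.

Definition at_distance C (k : nat) : set (R3 R) :=
  [set x | forall c, C c -> (k.+1%:R^-1 <= `|x - c|)%R].

Lemma closed_bigcup_at_distance C : closed C -> ~` C = \bigcup_k at_distance C k.
Proof.
move=> cC; apply/seteqP; split => [x Cx|x [k _ xk] Cx]; last first.
  have := xk _ Cx; rewrite subrr normr0 leNgt invr_gt0 ltr0n.
  by [].
have : nbhs x (~` C) by apply: open_nbhs_nbhs; split => //; exact: closed_openC.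
move=> /nbhs_ballP[e /= e0 eC]; have [k ke] := ltr_add_invr e0.
rewrite add0r in ke; exists k => // c Cc; rewrite leNgt; apply/negP => xc.
by apply: (eC c) Cc; rewrite -ball_normE /=; exact: lt_trans ke.
Qed.

(** A point [y] outside level [k.+1] is closer than [1 / (k + 2)] to some [c] in [C], while [x] at
    level [k] stays at least [1 / (k + 1)] away from the same [c]. *)
Lemma separated_at_distance A C k :
  separated (A `&` at_distance C k)
    (A `&` at_distance C k.+2 `\` at_distance C k.+1).
Proof.
exists (k.+1%:R^-1 - k.+2%:R^-1)%R.
  by rewrite subr_gt0 ltf_pV2 ?posrE ?ltr0n// ltr_nat.
move=> x y [_ xk] [_ /existsNP[c /not_implyP[Cc]]] /negP; rewrite -ltNge => yc.
rewrite lerBlDr; apply: le_trans (xk _ Cc) _.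
rewrite (_ : x - c = (x - y) + (y - c))%R; last by rewrite addrA subrK.
by rewrite (le_trans (ler_normD _ _))// lerD2l ltW.
Qed.

(* The shells between consecutive level sets of the distance to [C] are separated
   from all but one of their neighbours, so their measures are summable and the
   part of [A] close to [C] but outside of it is negligible in the limit. *)
Lemma closed_hausdorff2_measurable C :
  closed C -> (@hausdorff2 R).-cara.-measurable C.
Proof.
move=> cC; apply: le_caratheodory_measurable => A.
rewrite -[leLHS]/(hausdorff2 (A `&` C) + hausdorff2 (A `&` ~` C)).
rewrite -[leRHS]/(hausdorff2 A).
have := leey (hausdorff2 A); rewrite le_eqVlt => /predU1P[->|Aoo].
  by rewrite leey.
pose P k := A `&` at_distance C k.
pose f k := hausdorff2 (P k.+1 `\` P k).
have f0 k : 0 <= f k by exact: hausdorff2_ge0.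
have PA k : hausdorff2 (P k) <= hausdorff2 A by apply: le_hausdorff2 => x [].
have PS k : at_distance C k `<=` at_distance C k.+1.
  move=> x xk c Cc; apply: le_trans (xk _ Cc).
  by rewrite lef_pV2 ?posrE ?ltr0n// ler_nat.
(* The shell beyond level [k.+1] is separated from [P k] because the shell between them is
   skipped. *)
have step k : hausdorff2 (P k) + f k.+1 <= hausdorff2 (P k.+2).
  rewrite (_ : f k.+1 = hausdorff2 (P k.+2 `\` at_distance C k.+1)); last first.
    congr hausdorff2; apply/seteqP; split => x [[Ax x2] x1]; split => //.
      by move=> x1'; apply: x1.
    by case.
  apply: le_trans (hausdorff2_separated (separated_at_distance _ _ _)) _.
  by apply: le_hausdorff2 => x [[Ax /PS/PS]|[]].
(* Each use of [step] advances by two levels, so the even and the odd shells telescope separately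
   and both end values appear on the right. *)
have partial n : \sum_(0 <= k < n) f k.+1 <= hausdorff2 (P n) + hausdorff2 (P n.+1).
  elim: n => [|n IHn]; first by rewrite big_geq// adde_ge0// hausdorff2_ge0.
  rewrite big_nat_recr //= [leRHS]addeC; apply: le_trans (leeD IHn (lexx _)) _.
  by rewrite addeAC leeD.
have fsum : \sum_(0 <= k <oo) f k.+1 < +oo.
  apply: (@le_lt_trans _ _ (hausdorff2 A + hausdorff2 A)); last first.
    by rewrite lte_add_pinfty.
  apply: lime_le; first by apply: is_cvg_nneseries => *; exact: f0.
  by near=> n; apply: le_trans (partial n) _; exact: leeD.
have tail n : hausdorff2 (A `&` ~` C) <=
    hausdorff2 (P n.+1) + \sum_(n <= k <oo) f k.+1.
  apply: le_trans (leeD (lexx _) (outer_measure_sigma_subadditive_tail _ _ _)).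
  apply: le_trans (outer_measureU2 _ _ _); apply: le_outer_measure => x [Ax].
  rewrite closed_bigcup_at_distance// => -[m _ xm].
  have [xn|xn] := pselect (at_distance C n.+1 x); [by left|right].
  (* The least level containing [x] exceeds [n.+1] because the levels increase; by minimality [x]
     lies in the shell between that level and the previous one. *)
  have ex : exists k, `[< at_distance C k x >] by exists m; apply/asboolP.
  case: (ex_minnP ex) => -[|k] /asboolP xk kmin.
    have incr i : at_distance C i x by elim: i => // i; exact: PS.
    by case: xn; exact: incr.
  have nk : (n < k)%N.
    rewrite ltnNge; apply/negP => kn; apply: xn.
    have incr i : at_distance C (k.+1 + i)%N x.
      by elim: i => [|i]; rewrite ?addn0// addnS; exact: PS.
    by have := incr (n - k)%N; rewrite addSn subnKC.
  move: k nk xk kmin => [//|k] nk xk kmin.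
  exists k => /=; first by apply/negP; rewrite -leqNgt -ltnS.
  split=> // -[_] /asboolP/kmin; by rewrite ltnn.
have /fine_cvgP[tfin tcvg] := nneseries_tail_cvg fsum (fun k _ => f0 k.+1).
apply/lee_addgt0Pr => e e0.
move/cvgrPdist_lt: tcvg => /(_ e e0) te.
near \oo => n.
have tn : \sum_(n <= k <oo) f k.+1 <= e%:E.
  rewrite -[leLHS]fineK; last by near: n.
  rewrite lee_fin; apply: le_trans (ler_norm _) _; rewrite -normrN -sub0r ltW//.
  by near: n.
apply: le_trans (leeD (lexx _) (tail n)) _.
rewrite addeA; apply: leeD => //.
(* [P n.+1] keeps the distance [1 / (n + 2)] from [C], so it is separated from the part of [A] in
   [C]. *)
apply: le_trans (hausdorff2_separated _) _; last first.
  by apply: le_hausdorff2 => x [[]|[]].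
exists (n.+2%:R^-1)%R; first by rewrite invr_gt0.
by move=> x y [_ Cx] [_ yn]; rewrite distrC; exact: yn.
Unshelve. all: by end_near. Qed.

Lemma closed_surf_measurable (C : set (R3 R)) : closed C ->
  measurable (C : set (caratheodory_type (@hausdorff2 R))).
Proof. exact: closed_hausdorff2_measurable. Qed.

Lemma surf_complete : measure_is_complete (@surf R).
Proof. exact: measure_is_complete_caratheodory. Qed.

End HausdorffMeasure.

(** * Complex-valued integrable, square integrable and bounded functions *)

Section ComplexL2.
Local Open Scope complex_scope.
Context {R : realType} {d : measure_display} {T : measurableType d}.
Variable mu : {measure set T -> \bar R}.
Implicit Types (D E : set T) (f g : T -> R[i]).

Lemma cabs_sqr (z : R[i]) : cabs z ^+ 2 = complex.Re z ^+ 2 + complex.Im z ^+ 2.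
Proof. by case: z => a b; rewrite /cabs /= sqr_sqrtr// addr_ge0// sqr_ge0. Qed.

Lemma cabs_ge0 (z : R[i]) : 0 <= cabs z.
Proof. by case: z => a b; rewrite /cabs /= sqrtr_ge0. Qed.

Lemma cabsM (z w : R[i]) : cabs (z * w) = cabs z * cabs w.
Proof. exact: Normc.normcM. Qed.

Lemma cabs_conj (z : R[i]) : cabs (conjc z) = cabs z.
Proof. by case: z => a b; rewrite /cabs /= sqrrN. Qed.

Lemma cabs_le (z : R[i]) (M : R) : 0 <= M -> cabs z ^+ 2 <= M ^+ 2 -> cabs z <= M.
Proof. by move=> M0; rewrite ler_pXn2r ?nnegrE ?cabs_ge0. Qed.

Lemma normr_Re_le (z : R[i]) : `|complex.Re z| <= cabs z.
Proof.
case: z => a b; rewrite /cabs /= -sqrtr_sqr ler_wsqrtr//.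
by rewrite lerDl sqr_ge0.
Qed.

Lemma normr_Im_le (z : R[i]) : `|complex.Im z| <= cabs z.
Proof.
case: z => a b; rewrite /cabs /= -sqrtr_sqr ler_wsqrtr//.
by rewrite lerDr sqr_ge0.
Qed.

Lemma Re_complexM (z w : R[i]) : complex.Re (z * w) =
  complex.Re z * complex.Re w - complex.Im z * complex.Im w.
Proof. by case: z => a b; case: w. Qed.

Lemma Im_complexM (z w : R[i]) : complex.Im (z * w) =
  complex.Re z * complex.Im w + complex.Im z * complex.Re w.
Proof. by case: z => a b; case: w => c e /=. Qed.

Lemma Re_complexD (z w : R[i]) : complex.Re (z + w) = complex.Re z + complex.Re w.
Proof. by case: z => a b; case: w. Qed.

Lemma Im_complexD (z w : R[i]) : complex.Im (z + w) = complex.Im z + complex.Im w.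
Proof. by case: z => a b; case: w. Qed.

Lemma Re_complexV (z : R[i]) : complex.Re z^-1 = complex.Re z / cabs z ^+ 2.
Proof. by rewrite cabs_sqr; case: z. Qed.

Lemma Im_complexV (z : R[i]) : complex.Im z^-1 = - complex.Im z / cabs z ^+ 2.
Proof. by rewrite cabs_sqr; case: z => a b; rewrite /= mulNr. Qed.

(** Inversion is continuous away from 0, and the single point 0 is split off. *)
Lemma measurable_fun_inv D (u : T -> R) :
  measurable_fun D u -> measurable_fun D (fun x => (u x)^-1).
Proof.
move=> mfu; apply: (measurableT_comp _ mfu).
rewrite -(setUv [set 0]); apply/measurable_funU; [exact: measurable_set1| |split].
- by apply: measurableC; exact: measurable_set1.
- exact: measurable_fun_set1.
- apply: open_continuous_measurable_fun; first by apply: closed_openC; exact: closed_eq.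
  by move=> x; rewrite inE /= => /eqP x0; exact: inv_continuous.
Qed.

Lemma cmeasurable_cst D (c : R[i]) : cmeasurable_fun D (cst c).
Proof. by split; exact: measurable_cst. Qed.

Lemma cmeasurableD D f g : cmeasurable_fun D f -> cmeasurable_fun D g ->
  cmeasurable_fun D (fun x => f x + g x).
Proof.
move=> [f1 f2] [g1 g2]; split.
  by under eq_fun do rewrite Re_complexD; exact: measurable_funD.
by under eq_fun do rewrite Im_complexD; exact: measurable_funD.
Qed.

Lemma cmeasurableM D f g : cmeasurable_fun D f -> cmeasurable_fun D g ->
  cmeasurable_fun D (fun x => f x * g x).
Proof.
move=> [f1 f2] [g1 g2]; split.
  under eq_fun do rewrite Re_complexM.
  by apply: measurable_funB; exact: measurable_funM.
under eq_fun do rewrite Im_complexM.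
by apply: measurable_funD; exact: measurable_funM.
Qed.

Lemma measurable_cabs_sqr D f : cmeasurable_fun D f ->
  measurable_fun D (fun x => cabs (f x) ^+ 2).
Proof.
move=> [f1 f2]; under eq_fun do rewrite cabs_sqr.
by apply: measurable_funD; exact: measurable_funX.
Qed.

Lemma measurable_cabs D f : cmeasurable_fun D f ->
  measurable_fun D (fun x => cabs (f x)).
Proof.
move=> mf; rewrite (_ : (fun x => _) = Num.sqrt \o (fun x => cabs (f x) ^+ 2)).
  apply: measurableT_comp; last exact: measurable_cabs_sqr.
  by apply: continuous_measurable_fun; exact: sqrt_continuous.
by apply/funext => x /=; rewrite sqrtr_sqr ger0_norm// cabs_ge0.
Qed.

Lemma cmeasurableV D f : cmeasurable_fun D f -> cmeasurable_fun D (fun x => (f x)^-1).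
Proof.
move=> mf; have mi := measurable_fun_inv (measurable_cabs_sqr mf).
case: mf => f1 f2; split.
  by under eq_fun do rewrite Re_complexV; exact: measurable_funM.
under eq_fun do rewrite Im_complexV.
by apply: measurable_funM => //; exact: measurable_funN.
Qed.

Lemma cmeasurable_conj D f : cmeasurable_fun D f ->
  cmeasurable_fun D (fun x => conjc (f x)).
Proof.
move=> [f1 f2]; split.
  rewrite (_ : (fun x => _) = (fun x => complex.Re (f x)))//.
  by apply/funext => x; case: (f x).
rewrite (_ : (fun x => _) = (fun x => - complex.Im (f x))); first exact: measurable_funN.
by apply/funext => x; case: (f x).
Qed.

Lemma integrable_realD D (u v : T -> R) : measurable D ->
  mu.-integrable D (EFin \o u) -> mu.-integrable D (EFin \o v) ->
  mu.-integrable D (EFin \o (fun x => u x + v x)).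
Proof. by move=> mD ui vi; exact: (integrableD mD ui vi). Qed.

Lemma integrable_realZ D (c : R) (u : T -> R) : measurable D ->
  mu.-integrable D (EFin \o u) -> mu.-integrable D (EFin \o (fun x => c * u x)).
Proof. by move=> mD ui; exact: (integrableZl mD c ui). Qed.

Lemma integrable_realB D (u v : T -> R) : measurable D ->
  mu.-integrable D (EFin \o u) -> mu.-integrable D (EFin \o v) ->
  mu.-integrable D (EFin \o (fun x => u x - v x)).
Proof. by move=> mD ui vi; exact: (integrableB mD ui vi). Qed.

Lemma ae_le_integrable D (u v : T -> R) : measurable D -> measurable_fun D u ->
  mu.-integrable D (EFin \o v) -> {ae mu, forall x, D x -> `|u x| <= v x} ->
  mu.-integrable D (EFin \o u).
Proof.
move=> mD mfu vi uv; apply/integrableP; split; first exact/measurable_EFinP.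
have [mv vfin] := integrableP _ _ _ vi.
apply: le_lt_trans vfin; apply: ae_ge0_le_integral => //.
- by apply: measurableT_comp => //; exact/measurable_EFinP.
- exact: measurableT_comp.
- apply: filterS uv => x uvx Dx; rewrite /= lee_fin (le_trans (uvx Dx))//.
  exact: ler_norm.
Qed.

(** Since [v - u] is nonnegative only almost everywhere, it is replaced under the integral by its
    absolute value. *)
Lemma ae_le_Rintegral D (u v : T -> R) : measurable D ->
  mu.-integrable D (EFin \o u) -> mu.-integrable D (EFin \o v) ->
  {ae mu, forall x, D x -> u x <= v x} ->
  \int[mu]_(x in D) u x <= \int[mu]_(x in D) v x.
Proof.
move=> mD ui vi uv; rewrite -subr_ge0 -RintegralB//.
have wi : mu.-integrable D (EFin \o (fun x => v x - u x)) by exact: integrable_realB.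
rewrite (_ : \int[mu]_(x in D) _ = \int[mu]_(x in D) `|v x - u x|).
  by apply: Rintegral_ge0.
congr fine; apply: ae_eq_integral => //; first exact: measurable_int wi.
  exact: measurable_int (integrable_norm wi).
apply: filterS uv => x uvx Dx /=; rewrite ger0_norm// subr_ge0; exact: uvx.
Qed.

Definition cintegrable D f : Prop :=
  mu.-integrable D (EFin \o (fun x => complex.Re (f x))) /\
  mu.-integrable D (EFin \o (fun x => complex.Im (f x))).

Lemma ae_le_cintegrable D f (v : T -> R) : measurable D -> cmeasurable_fun D f ->
  mu.-integrable D (EFin \o v) -> {ae mu, forall x, D x -> cabs (f x) <= v x} ->
  cintegrable D f.
Proof.
move=> mD [f1 f2] vi fv.
split; apply: ae_le_integrable vi _ => //; apply: filterS fv => x fvx Dx.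
  exact: le_trans (normr_Re_le _) (fvx Dx).
exact: le_trans (normr_Im_le _) (fvx Dx).
Qed.

Lemma cintegralD D f g : measurable D -> cintegrable D f -> cintegrable D g ->
  cintegral mu D (fun x => f x + g x) = cintegral mu D f + cintegral mu D g.
Proof.
move=> mD [f1 f2] [g1 g2]; rewrite /cintegral.
under eq_Rintegral do rewrite Re_complexD.
under [X in _ +i* X]eq_Rintegral do rewrite Im_complexD.
by rewrite !RintegralD.
Qed.

Lemma cintegrableD D f g : measurable D -> cintegrable D f -> cintegrable D g ->
  cintegrable D (fun x => f x + g x).
Proof.
move=> mD [f1 f2] [g1 g2]; split.
  rewrite (_ : _ \o _ = EFin \o (fun x => complex.Re (f x) + complex.Re (g x))).
    exact: integrable_realD.
  by apply/funext => x /=; rewrite Re_complexD.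
rewrite (_ : _ \o _ = EFin \o (fun x => complex.Im (f x) + complex.Im (g x))).
  exact: integrable_realD.
by apply/funext => x /=; rewrite Im_complexD.
Qed.

Lemma L2_integrable D f : measurable D -> L2 mu D f ->
  mu.-integrable D (EFin \o (fun x => cabs (f x) ^+ 2)).
Proof.
move=> mD [mf fi]; apply/integrableP; split.
  by apply/measurable_EFinP; exact: measurable_cabs_sqr.
by under eq_integral do rewrite /= ger0_norm ?sqr_ge0//.
Qed.

Lemma ae_le_L2 D f (v : T -> R) : measurable D -> cmeasurable_fun D f ->
  mu.-integrable D (EFin \o v) -> {ae mu, forall x, D x -> cabs (f x) ^+ 2 <= v x} ->
  L2 mu D f.
Proof.
move=> mD mf vi fv; split => //.
have /integrableP[_] : mu.-integrable D (EFin \o (fun x => cabs (f x) ^+ 2)).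
  apply: ae_le_integrable vi _ => //; first exact: measurable_cabs_sqr.
  by apply: filterS fv => x fvx Dx; rewrite ger0_norm ?sqr_ge0//; exact: fvx.
by under eq_integral do rewrite /= ger0_norm ?sqr_ge0//.
Qed.

Lemma cabs_sqrD_le (z w : R[i]) :
  cabs (z + w) ^+ 2 <= 2 * cabs z ^+ 2 + 2 * cabs w ^+ 2.
Proof.
rewrite !cabs_sqr Re_complexD Im_complexD.
have := sqr_ge0 (complex.Re z - complex.Re w).
have := sqr_ge0 (complex.Im z - complex.Im w); nra.
Qed.

Lemma L2D D f g : measurable D -> L2 mu D f -> L2 mu D g ->
  L2 mu D (fun x => f x + g x).
Proof.
move=> mD f2 g2; have [mf _] := f2; have [mg _] := g2.
apply: (@ae_le_L2 _ _ (fun x => 2 * cabs (f x) ^+ 2 + 2 * cabs (g x) ^+ 2)) => //.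
- exact: cmeasurableD.
- by apply: integrable_realD => //; apply: integrable_realZ => //; exact: L2_integrable.
- by apply: aeW => x _; exact: cabs_sqrD_le.
Qed.

Lemma L2M D a f : measurable D -> Linfty mu D a -> L2 mu D f ->
  L2 mu D (fun x => a x * f x).
Proof.
move=> mD [ma [M aM]] f2; have [mf _] := f2.
apply: (@ae_le_L2 _ _ (fun x => M ^+ 2 * cabs (f x) ^+ 2)) => //.
- exact: cmeasurableM.
- by apply: integrable_realZ => //; exact: L2_integrable.
- apply: filterS aM => x aM Dx; rewrite cabsM exprMn ler_wpM2r ?sqr_ge0//.
  by rewrite ler_pXn2r ?nnegrE ?cabs_ge0 ?aM// (le_trans (cabs_ge0 _) (aM Dx)).
Qed.

(** Every interface term of the form is a product of this kind, which justifies splitting the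
    integrals. *)
Lemma L2_cintegrableM D f g : measurable D -> L2 mu D f -> L2 mu D g ->
  cintegrable D (fun x => f x * g x).
Proof.
move=> mD f2 g2; have [mf _] := f2; have [mg _] := g2.
apply: (@ae_le_cintegrable _ _ (fun x => cabs (f x) ^+ 2 + cabs (g x) ^+ 2)) => //.
- exact: cmeasurableM.
- by apply: integrable_realD => //; exact: L2_integrable.
- apply: aeW => x _; rewrite cabsM.
  have := sqr_ge0 (cabs (f x) - cabs (g x)).
  have := sqr_ge0 (cabs (f x)); have := sqr_ge0 (cabs (g x)); nra.
Qed.

Lemma L2_conj D f : L2 mu D f -> L2 mu D (fun x => conjc (f x)).
Proof.
move=> [mf fi]; split; first exact: cmeasurable_conj.
by under eq_integral do rewrite cabs_conj.
Qed.

Lemma Linfty_cst D (c : R[i]) : Linfty mu D (cst c).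
Proof.
by split; [exact: cmeasurable_cst|exists (cabs c); exact: aeW].
Qed.

Lemma LinftyM D a b : measurable D -> Linfty mu D a -> Linfty mu D b ->
  Linfty mu D (fun x => a x * b x).
Proof.
move=> mD [ma [M aM]] [mb [N bN]]; split; first exact: cmeasurableM.
exists (M * N); apply: filterS2 aM bN => x aM bN Dx.
by rewrite cabsM ler_pM ?cabs_ge0 ?aM ?bN.
Qed.

Lemma cmeasurable_funS D E f : measurable D -> E `<=` D ->
  cmeasurable_fun D f -> cmeasurable_fun E f.
Proof. by move=> mD ED [f1 f2]; split; exact: measurable_funS ED _. Qed.

Lemma L2S D E f : measurable D -> measurable E -> E `<=` D ->
  L2 mu D f -> L2 mu E f.
Proof.
move=> mD mE ED [mf fi]; split; first exact: cmeasurable_funS ED mf.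
apply: le_lt_trans fi; apply: ge0_subset_integral => //.
  by apply/measurable_EFinP; exact: measurable_cabs_sqr.
by move=> x _; rewrite lee_fin sqr_ge0.
Qed.

Lemma LinftyS D E f : measurable D -> E `<=` D -> Linfty mu D f -> Linfty mu E f.
Proof.
move=> mD ED [mf [M fM]]; split; first exact: cmeasurable_funS ED mf.
by exists M; apply: filterS fM => x fM /ED.
Qed.

Lemma L2_set0 f : L2 mu set0 f.
Proof.
by split; [split; exact: measurable_fun_set0|rewrite integral_set0 ltry].
Qed.

Lemma L2U D E f : measurable D -> measurable E ->
  L2 mu D f -> L2 mu E f -> L2 mu (D `|` E) f.
Proof.
move=> mD mE fD fE.
have mf : cmeasurable_fun (D `|` E) f.
  by have [[f1 f2] _] := fD; have [[g1 g2] _] := fE; split; apply/measurable_funU.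
split => //.
have DE : D `|` E = D `|` (E `\` D).
  apply/seteqP; split => x; last by move=> [|[]]; [left|right].
  by have [Dx|Dx] := pselect (D x); [left|move=> [//|Ex]; right].
have mED : measurable (E `\` D) by exact: measurableD.
have [_ fE'] := L2S mE mED (@subDsetl _ _ _) fE.
rewrite DE ge0_integral_setU//.
- by rewrite lte_add_pinfty//; case: fD.
- by rewrite -DE; apply/measurable_EFinP; exact: measurable_cabs_sqr.
- by move=> x _; rewrite lee_fin sqr_ge0.
- by apply/disj_setPS => x [? []].
Qed.

(** Serves to glue the normal derivative together from the elements of a mesh. *)
Lemma L2_bigcup_seq (I : choiceType) (s : seq I) (F : I -> set T) f :
  (forall i, i \in s -> measurable (F i)) -> (forall i, i \in s -> L2 mu (F i) f) ->
  L2 mu (\bigcup_(i in [set` s]) F i) f.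
Proof.
rewrite bigcup_seq; elim: s => [|i s IHs] mF fF.
  by rewrite big_nil; exact: L2_set0.
rewrite big_cons; apply: L2U.
- by apply: mF; rewrite mem_head.
- rewrite -bigcup_seq; apply: fin_bigcup_measurable => // k /= ks.
  by apply: mF; rewrite in_cons ks orbT.
- by apply: fF; rewrite mem_head.
- by apply: IHs => k ks; [apply: mF|apply: fF]; rewrite in_cons ks orbT.
Qed.

Lemma L2_sum (I : Type) (s : seq I) (F : I -> T -> R[i]) D : measurable D ->
  (forall i, L2 mu D (F i)) -> L2 mu D (fun x => \sum_(i <- s) F i x).
Proof.
move=> mD FD; elim: s => [|i s IHs].
  under eq_fun do rewrite big_nil.
  split; first exact: cmeasurable_cst.
  under eq_integral do rewrite /cabs /= expr0n addr0 sqrtr0 expr0n.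
  by rewrite integral0 ltry.
by under eq_fun do rewrite big_cons; exact: L2D.
Qed.

Lemma cintegral_real D f (u : T -> R) : (forall x, f x = (u x)%:C) ->
  cintegral mu D f = (\int[mu]_(x in D) u x)%:C.
Proof.
move=> fu; rewrite /cintegral.
under eq_Rintegral do rewrite fu.
under [X in _ +i* X]eq_Rintegral do rewrite fu /=.
by rewrite /Rintegral integral0.
Qed.

Lemma cintegrableN D f : measurable D -> cintegrable D f ->
  cintegrable D (fun x => - f x).
Proof.
move=> mD [f1 f2]; split.
  rewrite (_ : _ \o _ = EFin \o (fun x => -1 * complex.Re (f x))).
    exact: integrable_realZ.
  by apply/funext => x /=; case: (f x) => a b; rewrite /= mulN1r.
rewrite (_ : _ \o _ = EFin \o (fun x => -1 * complex.Im (f x))).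
  exact: integrable_realZ.
by apply/funext => x /=; case: (f x) => a b; rewrite /= mulN1r.
Qed.

Lemma cintegralB D f g : measurable D -> cintegrable D f -> cintegrable D g ->
  cintegral mu D (fun x => f x - g x) = cintegral mu D f - cintegral mu D g.
Proof.
move=> mD fi gi; apply/eqP; rewrite -subr_eq0 opprB addrA subr_eq0 -cintegralD//.
  by under [X in cintegral _ _ X]eq_fun do rewrite subrK.
by apply: cintegrableD => //; exact: cintegrableN.
Qed.

End ComplexL2.

(** * Changes on null sets, for a complete measure *)

Section CompleteMeasure.
Context {R : realType} {d : measure_display} {T : measurableType d}.
Variable mu : {measure set T -> \bar R}.
Hypothesis cmu : measure_is_complete mu.

(** The normal derivatives are prescribed only almost everywhere; completeness still makes them
    measurable. *)
Lemma ae_cmeasurable (D : set T) (f g : T -> R[i]) :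
  {ae mu, forall x, D x -> f x = g x} -> cmeasurable_fun D f -> cmeasurable_fun D g.
Proof.
move=> fg [f1 f2]; split; apply/measurable_EFinP.
  apply: (ae_measurable_fun cmu (f := EFin \o (fun x => complex.Re (f x)))).
    by apply: filterS fg => x fg Dx /=; rewrite fg.
  exact/measurable_EFinP.
apply: (ae_measurable_fun cmu (f := EFin \o (fun x => complex.Im (f x)))).
  by apply: filterS fg => x fg Dx /=; rewrite fg.
exact/measurable_EFinP.
Qed.

Lemma ae_L2 (D : set T) (f g : T -> R[i]) : measurable D ->
  {ae mu, forall x, D x -> f x = g x} -> L2 mu D f -> L2 mu D g.
Proof.
move=> mD fg f2; have [mf _] := f2.
apply: (@ae_le_L2 _ _ _ _ _ _ (fun x => cabs (f x) ^+ 2)) => //.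
- exact: ae_cmeasurable mf.
- exact: L2_integrable.
- by apply: filterS fg => x fg Dx; rewrite fg.
Qed.

End CompleteMeasure.

(** * Closedness of the interface, of boundaries and of hulls *)

Section Topology.
Variable R : realType.
Implicit Types (W : set (R3 R)) (V : {fset R3 R}).

Lemma interfaceC W1 W2 : interface W1 W2 = interface W2 W1.
Proof. by rewrite /interface setIC. Qed.

Lemma closed_interface W1 W2 : closed (interface W1 W2).
Proof. by apply: closedI; exact: closed_closure. Qed.

(** [W1] is a neighbourhood of each of its points and misses [W2], so none of them lies in the
    closure of [W2]. *)
Lemma interface_sub_bdry W1 W2 : open W1 -> W1 `&` W2 = set0 ->
  interface W1 W2 `<=` bdry W1.
Proof.
move=> oW1 W12 x [x1 x2]; split=> // /interior_subset W1x.
have /x2[y [W2y W1y]] : nbhs x W1 by exact: open_nbhs_nbhs.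
by have : (W1 `&` W2) y by []; rewrite W12.
Qed.

Lemma closed_bdry W : closed (bdry W).
Proof.
rewrite /bdry setDE; apply: closedI; first exact: closed_closure.
by apply: open_closedC; exact: open_interior.
Qed.

(* The hull of [V] is the slice of height 1 of the zonotope of the points (1, v),
   which is compact as a sum of segments. *)
Definition zonotope (s : seq (R3 R)) : set (R * R3 R) := [set p | exists t : R3 R -> R,
  (forall v, v \in s -> 0 <= t v <= 1) /\
  p = (\sum_(v <- s) t v, \sum_(v <- s) t v *: v)].

(** Prepending [v] adds a segment: the new zonotope is the image of the unit interval times the old
    one under the continuous map [f]. *)
Lemma compact_zonotope s : uniq s -> compact (zonotope s).
Proof.
elim: s => [_|v s IHs /= /andP[vs us]].
  rewrite (_ : zonotope _ = [set 0]); first exact: compact_set1.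
  apply/seteqP; split => [p [t [_ ->]]|_ ->]; first by rewrite !big_nil.
  by exists (cst 0); rewrite !big_nil.
pose f (q : R * (R * R3 R)) : R * R3 R := (q.1 + q.2.1, q.1 *: v + q.2.2).
rewrite (_ : zonotope _ = f @` (`[0, 1] `*` zonotope s)).
  apply: continuous_compact; last first.
    by apply: compact_setX; [exact: segment_compact|exact: IHs].
  apply: continuous_subspaceT => q; rewrite /continuous_at /f.
  have c1 : q0.1 + q0.2.1 @[q0 --> q] --> q.1 + q.2.1.
    by apply: cvgD; [exact: cvg_fst|exact: (cvg_comp snd fst cvg_snd cvg_fst)].
  have c2 : q0.1 *: v + q0.2.2 @[q0 --> q] --> q.1 *: v + q.2.2.
    apply: cvgD; last exact: (cvg_comp snd snd cvg_snd cvg_snd).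
    by apply: cvgZr_tmp; exact: cvg_fst.
  exact: (cvg_pair c1 c2).
apply/seteqP; split => [p [t [t01 ->]]|_ [[a q] /= [a01 [t [t01 ->]]] <-]].
  exists (t v, (\sum_(v <- s) t v, \sum_(v <- s) t v *: v)); last first.
    by rewrite /f /= !big_cons.
  split => /=; first by rewrite in_itv /= t01// mem_head.
  by exists t; split => // w ws; rewrite t01// in_cons ws orbT.
(* As [v] is not in [s], overriding the coefficient at [v] leaves the sums over [s] unchanged. *)
exists (fun w => if w == v then a else t w); split.
  move=> w; rewrite in_cons; have [_ _|_ ws] := eqVneq w v; last exact: t01.
  by move: a01; rewrite in_itv.
rewrite /f /= !big_cons eqxx; congr ((_ + _, _ + _)).
  by apply: eq_big_seq => w ws; have [wv|//] := eqVneq w v; rewrite -wv ws in vs.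
by apply: eq_big_seq => w ws; have [wv|//] := eqVneq w v; rewrite -wv ws in vs.
Qed.

Lemma closed_hull V : closed (hull V).
Proof.
have -> : hull V = (fun x => (1, x)) @^-1` zonotope V.
  apply/seteqP; split => [x [t [t0 t1 ->]]|x [t [t01 [t1 ->]]]].
    exists t; split; last by rewrite t1.
    (* Nonnegative coefficients with sum 1 are at most 1, as the zonotope requires. *)
    move=> v vV; rewrite t0//= -t1 (bigD1_seq v) ?fset_uniq//= lerDl.
    by rewrite big_seq_cond sumr_ge0// => w /andP[wV _]; exact: t0.
  by exists t; split => // v /t01/andP[].
apply: preimage_closed; last first.
  apply: compact_closed; first exact: norm_hausdorff.
  by apply: compact_zonotope; exact: fset_uniq.
by move=> x _; exact: (cvg_pair (cvg_cst _) cvg_id).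
Qed.

End Topology.

(* Type class search does not see through the instances on [surf]. *)
#[global] Instance ae_surf_filter (R : realType) :
  Filter (almost_everywhere (@surf R)).
Proof. exact: ae_filter_ringOfSetsType. Qed.

(** * Square integrability of the jump and the mean normal derivative on the interface *)

Section Traces.
Local Open Scope complex_scope.
Variable R : realType.
Implicit Types (W : set (R3 R)) (x y : R3 R) (n : R3 R -> R3 R).
(* [vector.coord] shadows the coordinates of points. *)
Local Notation coord := Defs.coord.
Local Notation cara := (caratheodory_type (@hausdorff2 R)).

Lemma coordZ (a : R) x j : coord (a *: x) j = a * coord x j.
Proof. by rewrite /coord; case: j => [[|[|[|]]]]. Qed.

Lemma coordN x j : coord (- x) j = - coord x j.
Proof. by rewrite /coord; case: j => [[|[|[|]]]]. Qed.

Lemma coord_grad phi x j : coord (grad phi x) j = pderiv j phi x.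
Proof.
rewrite /coord /grad -[in RHS](inord_val j).
by case: (nat_of_ord j) (ltn_ord j) => [|[|[|m]]].
Qed.

Lemma dotZ (a : R) x : dot (a *: x) (a *: x) = a ^+ 2 * dot x x.
Proof. by rewrite /dot mulr_sumr; apply: eq_bigr => i _; rewrite !coordZ; ring. Qed.

Lemma dot_gt0 x : x != 0 -> 0 < dot x x.
Proof.
move=> x0; rewrite lt_neqAle eq_sym; apply/andP; split; last first.
  by rewrite dotE -!expr2 !addr_ge0 ?sqr_ge0.
apply: contra_neq x0 => xx0; have := norm_le_enorm x.
by rewrite /enorm xx0 sqrtr0 normr_le0 => /eqP.
Qed.

Lemma enormK x : enorm x ^+ 2 = dot x x.
Proof. by rewrite sqr_sqrtr// dotE -!expr2 !addr_ge0 ?sqr_ge0. Qed.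

Lemma enorm_normalized x : x != 0 -> dot ((enorm x)^-1 *: x) ((enorm x)^-1 *: x) = 1.
Proof. by move=> x0; rewrite dotZ exprVn enormK mulVf// gt_eqF// dot_gt0. Qed.

Lemma coord_le1 x j : dot x x = 1 -> `|coord x j| <= 1.
Proof.
move=> x1; rewrite -(ler_pXn2r (n := 2)) ?nnegrE// expr1n real_normK ?num_real//.
by rewrite -x1 /dot (bigD1 j)//= -expr2 lerDl sumr_ge0// => i _; rewrite -expr2 sqr_ge0.
Qed.

(** The witness is a coordinate of the normalized gradient of [phi]: it is defined off the interface
    too, and is continuous at [x] because the gradient does not vanish there. *)
Lemma outward_normal_cvg W1 W2 U phi n1 x (j : 'I_3) :
  outward_normal W1 W2 n1 -> open U -> U x -> local_equation W1 W2 U phi ->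
  exists2 f : R3 R -> R, f y @[y --> x] --> f x &
    forall y, U y -> interface W1 W2 y -> coord (n1 y) j = f y.
Proof.
move=> hn1 oU Ux leq; exists (fun y => (enorm (grad phi y))^-1 * pderiv j phi y).
  have [smphi locphi] := leq; have [gx0 _ _ _] := locphi _ Ux.
  have cphi i : {for x, continuous (pderiv i phi)} by have [+ _] := smphi [:: i]; exact.
  apply: cvgM; last exact: cphi.
  apply: cvgV; first by rewrite gt_eqF// sqrtr_gt0 dot_gt0.
  apply: (@continuous_cvg _ _ _ _ _ _ Num.sqrt); first exact: sqrt_continuous.
  rewrite dotE; under eq_fun do rewrite dotE.
  by apply: cvgD; [apply: cvgD|]; apply: cvgM; exact: cphi.
by move=> y Uy Iy; rewrite (hn1 _ _ oU leq _ Uy Iy) coordZ coord_grad.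
Qed.

Variables (W W1 W2 Gio Gs : set (R3 R)) (n1 n : R3 R -> R3 R).
Hypothesis hgeo : split_domain W W1 W2 Gio Gs.
Hypothesis hn1 : outward_normal W1 W2 n1.
Hypothesis hn : n = n1 \/ n = (fun x => - n1 x).
Local Notation GI := (interface W1 W2).

Lemma measurable_interface : measurable (GI : set cara).
Proof. by apply: closed_surf_measurable; exact: closed_interface. Qed.

Lemma open_surf_measurable (A : set (R3 R)) : open A -> measurable (A : set cara).
Proof.
move=> oA; rewrite -[A]setCK; apply: measurableC.
by apply: closed_surf_measurable; exact: open_closedC.
Qed.

(** Local equations are given inside [W]; the rest of the interface is the exceptional set, null by
    [sd_interface_in]. *)
Lemma outer_normal_unit : {ae surf, forall x, GI x -> dot (n1 x) (n1 x) = 1}.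
Proof.
exists (GI `\` W); split.
- apply: measurableD; first exact: measurable_interface.
  by apply: open_surf_measurable; exact: sd_open hgeo.
- exact: sd_interface_in hgeo.
- move=> x /= /not_implyP[GIx nx]; split => // Wx; apply: nx.
  have [U [phi [oU Ux leq]]] := sd_interface_smooth hgeo (conj GIx Wx).
  have [gx0 _ _ _] := leq.2 _ Ux.
  by rewrite (hn1 oU leq Ux GIx) enorm_normalized.
Qed.

(** Inside [W] the normal is continuous along the interface. Outside [W] only a null set of the
    interface remains, on which every function is measurable by completeness. *)
Lemma measurable_outer_normal j :
  measurable_fun (GI : set cara) (fun x => coord (n1 x) j).
Proof.
pose A := GI `&` W.
have mW : measurable (W : set cara) by apply: open_surf_measurable; exact: sd_open hgeo.
have mA : measurable (A : set cara).
  by apply: measurableI => //; exact: measurable_interface.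
have mD : measurable (GI `\` W : set cara).
  by apply: measurableD => //; exact: measurable_interface.
pose f := (fun x => coord (n1 x) j) : cara -> R; rewrite -/f.
have -> : GI = A `|` (GI `\` W) by rewrite /A setUIDK.
apply/(measurable_funU f mA mD); split; last first.
  move=> _ Y mY; apply: surf_complete; exists (GI `\` W); split => //.
  exact: sd_interface_in hgeo.
apply: (measurability _ (RGenOpens.measurableE R)) => _ [_ [a [b ->] <-]].
pose Y := `]a, b[%classic.
(* The preimage of [Y] is relatively open in [A]. The implication admits all points off [A], so the
   interior, taken in the whole space, cuts exactly this preimage out of [A]. *)
rewrite (_ : _ `&` _ = A `&` [set y | A y -> Y (f y)]°).
  by apply: measurableI => //; apply: open_surf_measurable; exact: open_interior.
apply/seteqP; split => x [Ax]; last by move=> /interior_subset/(_ Ax).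
move=> Yx; split => //.
have [U [phi [oU Ux leq]]] := sd_interface_smooth hgeo Ax.
have [g gx fE] := outward_normal_cvg j hn1 oU Ux leq.
have nY : nbhs (g x) Y.
  apply: open_nbhs_nbhs; split; first exact: interval_open.
  by rewrite -fE//; case: Ax.
have Yg : \forall y \near x, Y (g y) by exact: gx.
have Un : \forall y \near x, U y by exact: open_nbhs_nbhs.
rewrite /interior /=; near=> y => -[GIy _]; rewrite /f fE//; last by near: y.
by near: y.
Unshelve. all: by end_near.
Qed.

Lemma Linfty_outer_normal j : Linfty surf GI (fun x => (coord (n1 x) j)%:C).
Proof.
split; last first.
  exists 1; apply: filterS outer_normal_unit => x n1x GIx.
  by rewrite /cabs /= expr0n addr0 sqrtr_sqr coord_le1// n1x.
by split; [exact: measurable_outer_normal|exact: measurable_cst].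
Qed.

Lemma Linfty_inner_normal j : Linfty surf GI (fun x => (coord (- n1 x) j)%:C).
Proof.
have := LinftyM measurable_interface (Linfty_cst surf GI (-1)) (Linfty_outer_normal j).
by under eq_fun do rewrite mulN1r -rmorphN -coordN.
Qed.

Lemma Linfty_normal j : Linfty surf GI (fun x => (coord (n x) j)%:C).
Proof.
by case: hn => ->; [exact: Linfty_outer_normal|exact: Linfty_inner_normal].
Qed.

(** The traces are square integrable on the whole boundaries, hence on the interface, and the
    normals are bounded. *)
Lemma L2_jump (p : dgfun R) : L2 surf (bdry W1) (dg_tr1 p) ->
  L2 surf (bdry W2) (dg_tr2 p) -> L2 surf GI (jump n1 n p).
Proof.
move=> t1 t2; have mGI := measurable_interface.
have mb (V : set (R3 R)) : measurable (bdry V : set cara).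
  by apply: closed_surf_measurable; exact: closed_bdry.
have {}t1 : L2 surf GI (dg_tr1 p).
  apply: L2S t1 => //; apply: interface_sub_bdry; first exact: sd_open1 hgeo.
  exact: sd_disjoint hgeo.
have {}t2 : L2 surf GI (dg_tr2 p).
  apply: L2S t2 => //; rewrite interfaceC; apply: interface_sub_bdry.
    exact: sd_open2 hgeo.
  by rewrite setIC; exact: sd_disjoint hgeo.
rewrite /jump; apply: (L2_sum _ mGI) => j; apply: (L2M mGI); first exact: Linfty_normal.
exact: (L2D mGI (L2M mGI (Linfty_outer_normal j) t1)
  (L2M mGI (Linfty_inner_normal j) t2)).
Qed.

(** On each element [q] agrees almost everywhere with a combination of square integrable traces with
    bounded coefficients, and finitely many elements cover the interface. *)
Lemma L2_normal_deriv T g q : GI `<=` \bigcup_(K in [set` T]) hull K ->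
  is_normal_deriv W1 W2 T n g q -> L2 surf GI q.
Proof.
move=> TGI qg; have mGI := measurable_interface.
have mK K : measurable (GI `&` hull K : set cara).
  by apply: measurableI => //; apply: closed_surf_measurable; exact: closed_hull.
rewrite (_ : GI = \bigcup_(K in [set` T]) (GI `&` hull K)); last first.
  by rewrite -setI_bigcupr; apply/esym/setIidPl.
apply: L2_bigcup_seq => K KT; first exact: mK.
have [t [trt qt]] := qg _ KT.
apply: (ae_L2 (@surf_complete R) (mK K)
  (f := fun x => \sum_j (coord (n x) j)%:C * t j x)).
  by apply: filterS qt => x qx /qx.
apply: (L2_sum _ (mK K)) => j.
have [_ [_ [_ [tj _]]]] := trt j.
exact: (L2M (mK K) (LinftyS mGI (@subIsetl _ _ _) (Linfty_normal j)) tj).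
Qed.

Lemma L2_avg_dn T1 T2 (p : dgfun R) : triangulation W1 T1 -> triangulation W2 T2 ->
  is_normal_deriv W1 W2 T1 n (dg_grad p) (dg_dn1 p) ->
  is_normal_deriv W1 W2 T2 n (dg_grad p) (dg_dn2 p) -> L2 surf GI (avg_dn p).
Proof.
move=> [_ T1W _] [_ T2W _] p1 p2; have mGI := measurable_interface.
rewrite /avg_dn; under eq_fun do rewrite mulrC.
apply: (L2M mGI (Linfty_cst surf GI 2^-1)); apply: (L2D mGI).
  by apply: L2_normal_deriv p1; rewrite -T1W; exact: subIsetl.
by apply: L2_normal_deriv p2; rewrite -T2W; exact: subIsetr.
Qed.

Lemma jump_dg_conj (p : dgfun R) x : jump n1 n (dg_conj p) x = conjc (jump n1 n p x).
Proof.
rewrite /jump rmorph_sum; apply: eq_bigr => j _ /=.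
by rewrite !(rmorphM, rmorphD) /= oppr0.
Qed.

Lemma avg_dn_dg_conj (p : dgfun R) x : avg_dn (dg_conj p) x = conjc (avg_dn p x).
Proof.
by rewrite /avg_dn /= rmorphM rmorphD fmorphV rmorph_nat.
Qed.

End Traces.

(** * Pointwise estimates on the interface *)

Section Coercivity.
Local Open Scope complex_scope.
Variable R : realType.
Implicit Types (z w lam J D zeta : R[i]) (kappa delta s : R).

Lemma mulC_conjc z : z * conjc z = (cabs z ^+ 2)%:C.
Proof.
rewrite cabs_sqr; case: z => a b; apply/eqP; rewrite eq_complex /=.
by apply/andP; split; apply/eqP; ring.
Qed.

(** Division by [i] is a rotation: for positive [kappa] the real part inherits the sign of
    [Im zeta], and [Re zeta >= 0] makes the imaginary part nonpositive. *)
Lemma scaled_zetaE kappa zeta : kappa != 0 ->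
  zeta / ('i%C * kappa%:C) = (complex.Im zeta / kappa) -i* (complex.Re zeta / kappa).
Proof.
move=> k0; have ik0 : 'i%C * kappa%:C != 0 :> R[i].
  by rewrite mulf_neq0// eq_complex /= ?(negPf k0) ?oner_eq0 ?andbF.
apply: (mulIf ik0); rewrite mulfVK//; apply/eqP; rewrite eq_complex.
case: zeta => a b /=; apply/andP; split; apply/eqP; field; exact: k0.
Qed.

(** With [w = s + z] and [X = J - s D] one has [J + z D = X + w D]. As [lam = 1 / w], the mixed
    terms in [X] and [D] and the multiples of [w |D|^2] cancel. Here [z] is never conjugated, since
    the form is bilinear. *)
Lemma interface_integrandE s z J D : s%:C + z != 0 ->
  let lam := (s%:C + z)^-1 in
  z * D * conjc D + lam * (J + z * D) * (conjc J + z * conjc D)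
    - D * (conjc J + z * conjc D) - (J + z * D) * conjc D
  = lam * (cabs (J - s%:C * D) ^+ 2)%:C - (s * cabs D ^+ 2)%:C.
Proof.
move=> w0 lam.
have -> : (cabs (J - s%:C * D) ^+ 2)%:C =
    (J - s%:C * D) * (conjc J - s%:C * conjc D).
  by rewrite -mulC_conjc rmorphB rmorphM /= oppr0.
have -> : (s * cabs D ^+ 2)%:C = s%:C * (D * conjc D).
  by rewrite mulC_conjc; apply/eqP; rewrite eq_complex /= !mul0r !mulr0 subr0 addr0 !eqxx.
rewrite /lam {lam} [in LHS](_ : z = (s%:C + z) - s%:C); last by ring.
by move: (s%:C + z) w0 => w w0; field.
Qed.

(** The right side minus the left side is half of [|J - 2 s D|^2]. *)
Lemma cabs_sqrB_ge s J D :
  2^-1 * cabs J ^+ 2 - s ^+ 2 * cabs D ^+ 2 <= cabs (J - s%:C * D) ^+ 2.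
Proof.
rewrite !cabs_sqr; case: J D => [a b] [c e] /=.
have := sqr_ge0 (a - 2 * (s * c)); have := sqr_ge0 (b - 2 * (s * e)); nra.
Qed.

Lemma cabs_sqrB_le s J D :
  cabs (J - s%:C * D) ^+ 2 <= 2 * cabs J ^+ 2 + 2 * (s ^+ 2 * cabs D ^+ 2).
Proof.
rewrite !cabs_sqr; case: J D => [a b] [c e] /=.
have := sqr_ge0 (a + s * c); have := sqr_ge0 (b + s * e); nra.
Qed.

Lemma cabs_le_ReDIm z : 0 <= complex.Re z -> 0 <= complex.Im z ->
  cabs z <= complex.Re z + complex.Im z.
Proof.
move=> a0 b0; apply: cabs_le; first exact: addr_ge0.
by rewrite cabs_sqr; nra.
Qed.

Lemma ReDIm_ge z : 0 <= complex.Im z -> - cabs z <= complex.Re z + complex.Im z.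
Proof.
move=> b0; have := normr_Re_le z; rewrite ler_norml => /andP[az _].
by rewrite (le_trans az)// lerDl.
Qed.

Lemma ReDIm_le_cabs z : 2^-1 * (complex.Re z + complex.Im z) <= cabs z.
Proof.
have := le_trans (ler_norm _) (normr_Re_le z).
have := le_trans (ler_norm _) (normr_Im_le z); lra.
Qed.

(** Here [a] is the modulus of the form, [G] and [P] are the squared norms of the gradient and the
    function, and [B] is the boundary term. [L], [E] and [j] are the integrals of [|lam| |J|^2], of
    [s |D|^2], and of [|J|^2] where [Im zeta < 0]. Of the available [G / 2], one half remains and
    the other pays for [5 E / 4]. *)
Lemma energy_combination (a kappa delta G P B L E j Sr Si : R) :
  0 <= G -> 0 <= P -> 0 <= kappa * B -> 16 * E <= G ->
  4^-1 * L - E - 2 * kappa / delta * j <= 2^-1 * (Sr + Si) ->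
  2^-1 * (G - kappa ^+ 2 * P + Sr + (kappa * B + Si)) <= a ->
  4^-1 * (G + kappa ^+ 2 * P + E + L) <=
    a + 2 * kappa * (kappa * P + delta^-1 * j).
Proof.
move=> G0 P0 B0 E16 hS ha; have kP : 0 <= kappa ^+ 2 * P by rewrite mulr_ge0 ?sqr_ge0.
rewrite (_ : 2 * kappa * _ = 2 * (kappa ^+ 2 * P) + 2 * kappa / delta * j); last by ring.
lra.
Qed.

Lemma cabsV z : cabs z^-1 = (cabs z)^-1.
Proof.
have [->|z0] := eqVneq z 0; first by rewrite invr0 /cabs /= expr0n addr0 sqrtr0 invr0.
have cz0 : cabs z != 0 by apply: contra_neq z0 => /Normc.eq0_normc.
apply: (mulIf cz0); rewrite -cabsM mulVf// mulVf//.
by rewrite /cabs /= expr1n expr0n addr0 sqrtr1.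
Qed.

(** As [Im zeta >= 0], the real part of [w] is at least [s], which bounds [|w|] from below. *)
Lemma stab_lam_plus kappa s zeta : 0 < kappa -> 0 < s ->
  0 <= complex.Re zeta -> 0 <= complex.Im zeta ->
  let w := s%:C + zeta / ('i%C * kappa%:C) in
  [/\ w != 0, 0 <= complex.Re w^-1, 0 <= complex.Im w^-1 & cabs w^-1 * s <= 1].
Proof.
move=> k0 s0 re im w.
have wE : w = (s + complex.Im zeta / kappa) -i* (complex.Re zeta / kappa).
  by rewrite /w scaled_zetaE ?gt_eqF//; apply/eqP; rewrite eq_complex /= add0r !eqxx.
have Rew : s <= complex.Re w by rewrite wE /= lerDl divr_ge0// ltW.
have sw : s <= cabs w by apply: le_trans Rew (le_trans (ler_norm _) (normr_Re_le _)).
have w0 : 0 < cabs w by exact: lt_le_trans sw.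
split.
- by apply: contraTneq w0 => ->; rewrite /cabs /= expr0n addr0 sqrtr0 ltxx.
- by rewrite Re_complexV divr_ge0 ?sqr_ge0// (le_trans (ltW s0)).
- by rewrite Im_complexV divr_ge0 ?sqr_ge0// wE /= opprK divr_ge0// ltW.
- by rewrite cabsV mulrC ler_pdivrMr// mul1r.
Qed.

(** [|z| = |zeta| / kappa] is at least [delta / kappa] and [s] at most a quarter of [delta / kappa],
    so [|w| >= |z| - s >= 3 delta / (4 kappa) >= 3 s]. *)
Lemma stab_lam_minus kappa delta s zeta : 0 < kappa -> 0 < s -> 0 < delta ->
  0 <= complex.Re zeta -> delta <= cabs zeta -> s <= delta / (4 * kappa) ->
  let w := s%:C + zeta / ('i%C * kappa%:C) in
  [/\ w != 0, 0 <= complex.Im w^-1, 3 * cabs w^-1 <= 4 * (kappa / delta) &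
      3 * (cabs w^-1 * s) <= 1].
Proof.
move=> k0 s0 d0 re zd sd w.
pose z := zeta / ('i%C * kappa%:C).
have wE : w = (s + complex.Im zeta / kappa) -i* (complex.Re zeta / kappa).
  by rewrite /w scaled_zetaE ?gt_eqF//; apply/eqP; rewrite eq_complex /= add0r !eqxx.
have zk : cabs z * kappa = cabs zeta.
  have kE : cabs (kappa%:C) = kappa.
    by rewrite /cabs /= expr0n addr0 sqrtr_sqr gtr0_norm.
  rewrite -[X in _ * X = _]kE -cabsM /z scaled_zetaE ?gt_eqF//.
  apply/eqP; rewrite -(@eqrXn2 _ 2) ?cabs_ge0// !cabs_sqr /=.
  by apply/eqP; field; rewrite gt_eqF.
have sk : 4 * (s * kappa) <= delta by move: sd; rewrite ler_pdivlMr ?mulr_gt0//; nra.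
have zs : cabs z <= cabs w + s.
  rewrite (_ : z = w - s%:C); last by rewrite /w addrC addKr.
  apply: cabs_le; first by rewrite addr_ge0 ?cabs_ge0// ltW.
  have := normr_Re_le w; rewrite ler_norml => /andP[rw _].
  have -> : cabs (w - s%:C) ^+ 2 = cabs w ^+ 2 - 2 * s * complex.Re w + s ^+ 2.
    by rewrite !cabs_sqr; case: (w) => a b /=; ring.
  nra.
have wk : 3 * delta <= 4 * (cabs w * kappa).
  have : cabs z * kappa <= (cabs w + s) * kappa by rewrite ler_pM2r.
  by rewrite zk; nra.
have w0 : 0 < cabs w by nra.
split.
- by apply: contraTneq w0 => ->; rewrite /cabs /= expr0n addr0 sqrtr0 ltxx.
- by rewrite Im_complexV divr_ge0 ?sqr_ge0// wE /= opprK divr_ge0// ltW.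
- rewrite cabsV ler_pdivrMr// mulrA mulrAC ler_pdivlMr//; nra.
- rewrite cabsV mulrA mulrAC ler_pdivrMr// mul1r; nra.
Qed.

Lemma interface_coercive kappa delta s zeta J D : 0 < kappa -> 0 < s -> 0 < delta ->
  0 <= complex.Re zeta ->
  (complex.Im zeta < 0 -> delta <= cabs zeta /\ s <= delta / (4 * kappa)) ->
  let z := zeta / ('i%C * kappa%:C) in
  let lam := (s%:C + z)^-1 in
  let F := z * D * conjc D + lam * (J + z * D) * (conjc J + z * conjc D)
    - D * (conjc J + z * conjc D) - (J + z * D) * conjc D in
  cabs lam <= s^-1 /\
  4^-1 * (cabs lam * cabs J ^+ 2) - s * cabs D ^+ 2
    - 2 * kappa / delta * (if complex.Im zeta < 0 then cabs J ^+ 2 else 0)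
  <= 2^-1 * (complex.Re F + complex.Im F).
Proof.
move=> k0 s0 d0 re im z lam F.
have lo := cabs_sqrB_ge s J D; have hi := cabs_sqrB_le s J D.
have L0 := cabs_ge0 lam; have j0 := sqr_ge0 (cabs J); have e0 := sqr_ge0 (cabs D).
have X0 := sqr_ge0 (cabs (J - s%:C * D)).
have FE : s%:C + z != 0 -> complex.Re F + complex.Im F =
    (complex.Re lam + complex.Im lam) * cabs (J - s%:C * D) ^+ 2 - s * cabs D ^+ 2.
  move=> w0; rewrite /F interface_integrandE// -/lam.
  by case: lam {F L0} => a b /=; ring.
have sV : cabs lam * s <= 1 -> cabs lam <= s^-1.
  by move=> Ls; rewrite -[_^-1]mul1r ler_pdivlMr.
move: lo hi j0 e0 X0 FE; move: (cabs (J - _) ^+ 2) (cabs J ^+ 2) (cabs D ^+ 2).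
move=> X j e lo hi j0 e0 X0 FE.
have [im_lt|im_ge] := ltP (complex.Im zeta) 0.
  have [zd sd] := im im_lt.
  have [w0 b0 Lk Ls] := stab_lam_minus k0 s0 d0 re zd sd.
  rewrite -/z -/lam in w0 b0 Lk Ls.
  split; first by apply: sV; have := mulr_ge0 L0 (ltW s0); lra.
  (* Only [Re lam + Im lam >= - |lam|] is available here. Since [|lam| s <= 1 / 3], the total loss
     in [e] is at most [5 / 6] of [s e]. The deficit [5 / 4 |lam| j] is at most
     [5 / 3 (kappa / delta) j], which the jump term with factor 2 absorbs. *)
  rewrite (FE w0); have ab := ReDIm_ge b0.
  have h1 : - cabs lam * X <= (complex.Re lam + complex.Im lam) * X by rewrite ler_wpM2r.
  have h2 : cabs lam * X <= cabs lam * (2 * j + 2 * (s ^+ 2 * e)) by rewrite ler_wpM2l.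
  have h3 : 3 * (cabs lam * s) * (s * e) <= 1 * (s * e) by rewrite ler_wpM2r// mulr_ge0// ltW.
  have h4 : 3 * cabs lam * j <= 4 * (kappa / delta) * j by rewrite ler_wpM2r.
  have h5 : 0 <= cabs lam * j by rewrite mulr_ge0.
  have h6 : 0 <= s * e by rewrite mulr_ge0// ltW.
  rewrite -[2 * kappa / delta]mulrA.
  move: (kappa / delta) h4 => q h4; nra.
have [w0 a0 b0 Ls] := stab_lam_plus k0 s0 re im_ge.
rewrite -/z -/lam in w0 a0 b0 Ls.
split; first exact: sV.
(* Half of [|lam| (j / 2 - s^2 e)] yields the constant [1 / 4], and [|lam| s <= 1] bounds the
   remaining loss by exactly [s e]. *)
rewrite (FE w0) mulr0 subr0; have ab := cabs_le_ReDIm a0 b0.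
have h1 : cabs lam * X <= (complex.Re lam + complex.Im lam) * X by rewrite ler_wpM2r.
have h2 : cabs lam * (2^-1 * j - s ^+ 2 * e) <= cabs lam * X by rewrite ler_wpM2l.
have h3 : cabs lam * s * (s * e) <= 1 * (s * e) by rewrite ler_wpM2r// mulr_ge0// ltW.
nra.
Qed.

End Coercivity.

(** * Integration of the pointwise estimate and conclusion *)

Section Stability.
Local Open Scope complex_scope.

(** One pair of meshes and one function are fixed; [hinv] combines the inverse inequality for [p]
    with the lower bound on [gamma]. *)
Lemma stability_of_inverse_inequality (R : realType)
  (W W1 W2 Gio Gs : set (R3 R)) (n1 n : R3 R -> R3 R)
  (T1 T2 : {fset {fset R3 R}})
  (kappa delta gamma h : R) (zeta : R3 R -> R[i]) (p : dgfun R)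
  (hgeo : split_domain W W1 W2 Gio Gs)
  (hn1 : outward_normal W1 W2 n1)
  (hn : n = n1 \/ n = (fun x => - n1 x))
  (hT1 : triangulation W1 T1) (hT2 : triangulation W2 T2)
  (hkappa : 0 < kappa)
  (hzeta : Linfty surf (interface W1 W2) zeta)
  (hRe : {ae surf, forall x, interface W1 W2 x -> 0 <= complex.Re (zeta x)})
  (hdelta : 0 < delta)
  (hzeta_delta : {ae surf, forall x,
     interface_minus W1 W2 zeta x -> delta <= cabs (zeta x)})
  (hgamma : 0 < gamma) (h0 : 0 < h)
  (hh : (h%:E <= max_mesh_size W1 W2 kappa gamma delta zeta)%E)
  (hp : dg_data W1 W2 T1 T2 n p)
  (hinv : 16 * (gamma^-1 * \int[surf]_(x in interface W1 W2) (h * cabs (avg_dn p x) ^+ 2))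
     <= grad_sq_norm W1 W2 p) :
    4^-1 * dg_norm_sq W1 W2 n1 n kappa gamma h (stab_lam kappa gamma h zeta) p
    <= cabs (a_lam W1 W2 Gio n1 n kappa zeta (stab_lam kappa gamma h zeta) p
         (dg_conj p))
       + 2 * kappa * (kappa * sq_norm W1 W2 p
           + delta^-1 * \int[surf]_(x in interface_minus W1 W2 zeta)
                          (cabs (jump n1 n p x) ^+ 2)).
Proof.
set lam := stab_lam _ _ _ _; set GI := interface W1 W2.
have mGI : measurable (GI : set (caratheodory_type (@hausdorff2 R))) :=
  measurable_interface W1 W2.
have [_ [g1 [F1 [_ [t1 _]]]] [g2 [F2 [_ [t2 _]]]] dn1 dn2] := hp.
pose J := jump n1 n p; pose D := avg_dn p; pose s := h / gamma.
have s0 : 0 < s by exact: divr_gt0.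
have LJ : L2 surf GI J := L2_jump hgeo hn1 hn t1 t2.
have LD : L2 surf GI D := L2_avg_dn hgeo hn1 hn hT1 hT2 dn1 dn2.
pose z := scaled_zeta kappa zeta.
have Lz : Linfty surf GI z := LinftyM mGI hzeta (Linfty_cst surf GI _).
have LD' : L2 surf GI (fun x => conjc (D x)) := L2_conj LD.
have LJ' : L2 surf GI (fun x => conjc (J x)) := L2_conj LJ.
have LR := L2D mGI LJ (L2M mGI Lz LD).
have LR' := L2D mGI LJ' (L2M mGI Lz LD').
have mminus : measurable
    (interface_minus W1 W2 zeta : set (caratheodory_type (@hausdorff2 R))).
  have [[_ mIm] _] := hzeta.
  have -> : interface_minus W1 W2 zeta =
      GI `&` (fun x => complex.Im (zeta x)) @^-1` `]-oo, 0[%classic.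
    by apply/seteqP; split => x [GIx] /=; rewrite in_itv.
  exact: mIm mGI _ (measurable_itv _).
(* If the part with [Im zeta < 0] is null, it is itself the exceptional set; otherwise the bound on
   [h], divided by [gamma], is the bound on [s]. *)
have minus_ae : {ae surf, forall x, GI x -> complex.Im (zeta x) < 0 ->
    delta <= cabs (zeta x) /\ s <= delta / (4 * kappa)}.
  move: hh; rewrite /max_mesh_size; case: ifPn => [/eqP Gm0 _|_ hle].
    exists (interface_minus W1 W2 zeta); split => // x /= /not_implyP[GIx].
    by move=> /not_implyP[].
  apply: filterS hzeta_delta => x zx GIx im; split; first exact: zx.
  rewrite lee_fin in hle; rewrite /s ler_pdivrMr//; apply: le_trans hle _.
  by rewrite -mulrA mulrC.
pose F x := z x * D x * conjc (D x)
  + lam x * (J x + z x * D x) * (conjc (J x) + z x * conjc (D x))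
  - D x * (conjc (J x) + z x * conjc (D x)) - (J x + z x * D x) * conjc (D x).
(* The jump term is extended by 0 so that the pointwise estimate can be integrated over the whole
   interface. *)
pose Jm x := if complex.Im (zeta x) < 0 then cabs (J x) ^+ 2 else 0.
have pw : {ae surf, forall x, GI x -> cabs (lam x) <= s^-1 /\
    4^-1 * (cabs (lam x) * cabs (J x) ^+ 2) - s * cabs (D x) ^+ 2
      - 2 * kappa / delta * Jm x <= 2^-1 * (complex.Re (F x) + complex.Im (F x))}.
  apply: filterS2 hRe minus_ae => x re im GIx.
  exact: (interface_coercive (J x) (D x) hkappa s0 hdelta (re GIx) (im GIx)).
(* The bound [1 / s] on [lam] is the first half of the pointwise estimate, so integrability of the
   [lam] terms rests on [pw]. *)
have Llam : Linfty surf GI lam.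
  split; last by exists s^-1; apply: filterS pw => x pwx /pwx[].
  apply: cmeasurableV; apply: cmeasurableD; first exact: cmeasurable_cst.
  by case: Lz.
have i1 := L2_cintegrableM mGI LD LR'.
have i2 := L2_cintegrableM mGI LR LD'.
have i3 := L2_cintegrableM mGI (L2M mGI Lz LD) LD'.
have i4 := L2_cintegrableM mGI (L2M mGI Llam LR) LR'.
have i34 := cintegrableD mGI i3 i4.
have i341 := cintegrableD mGI i34 (cintegrableN mGI i1).
have iF : cintegrable surf GI F := cintegrableD mGI i341 (cintegrableN mGI i2).
pose S := cintegral surf GI F.
have SE : S = cintegral surf GI (fun x => z x * D x * conjc (D x))
    + cintegral surf GI
        (fun x => lam x * (J x + z x * D x) * (conjc (J x) + z x * conjc (D x)))
    - cintegral surf GI (fun x => D x * (conjc (J x) + z x * conjc (D x)))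
    - cintegral surf GI (fun x => (J x + z x * D x) * conjc (D x)).
  by rewrite /S /F (cintegralB mGI i341 i2) (cintegralB mGI i34 i1) (cintegralD mGI i3 i4).
pose B := \int[surf]_(x in Gio `&` bdry W1) (cabs (dg_tr1 p x) ^+ 2)
  + \int[surf]_(x in Gio `&` bdry W2) (cabs (dg_tr2 p x) ^+ 2).
have B0 : 0 <= B by apply: addr_ge0; apply: Rintegral_ge0 => x _; exact: sqr_ge0.
pose G := grad_sq_norm W1 W2 p; pose P := sq_norm W1 W2 p.
have G0 : 0 <= G by apply: Rintegral_ge0 => x _; apply: sumr_ge0 => j _; exact: sqr_ge0.
have P0 : 0 <= P by apply: Rintegral_ge0 => x _; exact: sqr_ge0.
(* Tested with the conjugate, the volume terms are real and the term on [Gio] is purely imaginary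
   with nonnegative imaginary part. *)
have aE : a_lam W1 W2 Gio n1 n kappa zeta lam p (dg_conj p) =
    G%:C - (kappa ^+ 2)%:C * P%:C + 'i%C * kappa%:C * B%:C + S.
  have a0E : a0 W1 W2 Gio kappa p (dg_conj p) =
      G%:C - (kappa ^+ 2)%:C * P%:C + 'i%C * kappa%:C * B%:C.
    have c1 : cintegral vol (W1 `|` W2) (cdot (dg_grad p) (dg_grad (dg_conj p))) = G%:C.
      apply: cintegral_real => x; rewrite /cdot.
      by rewrite rmorph_sum; apply: eq_bigr => j _; rewrite mulC_conjc.
    have c2 : cintegral vol (W1 `|` W2)
        (fun x => dg_val p x * dg_val (dg_conj p) x) = P%:C.
      by apply: cintegral_real => x; rewrite -mulC_conjc.
    have c3 V : cintegral surf V (fun x => dg_tr1 p x * dg_tr1 (dg_conj p) x) =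
        (\int[surf]_(x in V) (cabs (dg_tr1 p x) ^+ 2))%:C.
      by apply: cintegral_real => x; rewrite -mulC_conjc.
    have c4 V : cintegral surf V (fun x => dg_tr2 p x * dg_tr2 (dg_conj p) x) =
        (\int[surf]_(x in V) (cabs (dg_tr2 p x) ^+ 2))%:C.
      by apply: cintegral_real => x; rewrite -mulC_conjc.
    by rewrite /a0 c1 c2 c3 c4 /B [in RHS]rmorphD.
  have e1 : (fun x => avg_dn p x * robin_jump n1 n kappa zeta (dg_conj p) x) =
      (fun x => D x * (conjc (J x) + z x * conjc (D x))).
    by apply/funext => x; rewrite /robin_jump jump_dg_conj avg_dn_dg_conj.
  have e2 : (fun x => robin_jump n1 n kappa zeta p x * avg_dn (dg_conj p) x) =
      (fun x => (J x + z x * D x) * conjc (D x)).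
    by apply/funext => x; rewrite avg_dn_dg_conj.
  have e3 : (fun x => scaled_zeta kappa zeta x * avg_dn p x * avg_dn (dg_conj p) x) =
      (fun x => z x * D x * conjc (D x)).
    by apply/funext => x; rewrite avg_dn_dg_conj.
  have e4 : (fun x => lam x * robin_jump n1 n kappa zeta p x *
        robin_jump n1 n kappa zeta (dg_conj p) x) =
      (fun x => lam x * (J x + z x * D x) * (conjc (J x) + z x * conjc (D x))).
    by apply/funext => x; rewrite /robin_jump jump_dg_conj avg_dn_dg_conj.
  rewrite /a_lam a0E SE e1 e2 e3 e4; ring.
have reS : complex.Re (a_lam W1 W2 Gio n1 n kappa zeta lam p (dg_conj p)) =
  G - kappa ^+ 2 * P + complex.Re S.
  by rewrite aE; case: (S) => a b /=; ring.
have imS : complex.Im (a_lam W1 W2 Gio n1 n kappa zeta lam p (dg_conj p)) =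
  kappa * B + complex.Im S.
  by rewrite aE; case: (S) => a b /=; ring.
have iJ : surf.-integrable GI (EFin \o (fun x => cabs (J x) ^+ 2)) := L2_integrable mGI LJ.
have iD : surf.-integrable GI (EFin \o (fun x => cabs (D x) ^+ 2)) := L2_integrable mGI LD.
have iL : surf.-integrable GI (EFin \o (fun x => cabs (lam x) * cabs (J x) ^+ 2)).
  apply: (ae_le_integrable mGI _ (integrable_realZ s^-1 mGI iJ)).
    by apply: measurable_funM; [apply: measurable_cabs|apply: measurable_cabs_sqr];
      [case: Llam|case: LJ].
  apply: filterS pw => x pwx GIx; have [lx _] := pwx GIx.
  rewrite ger0_norm; last by rewrite mulr_ge0 ?cabs_ge0 ?sqr_ge0.
  by rewrite ler_wpM2r ?sqr_ge0.
have JmE : Jm = (fun x => cabs (J x) ^+ 2) \_ [set x | complex.Im (zeta x) < 0].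
  apply/funext => x; rewrite patchE /Jm.
  by case: ifPn => [xm|xm]; [rewrite mem_set|rewrite memNset//; exact/negP].
have JmI : \int[surf]_(x in GI) Jm x =
    \int[surf]_(x in interface_minus W1 W2 zeta) (cabs (J x) ^+ 2).
  by rewrite JmE -Rintegral_mkcondr.
have iJm : surf.-integrable GI (EFin \o Jm).
  apply: (ae_le_integrable mGI _ iJ); last first.
    apply: aeW => x _; rewrite /Jm; case: ifP => _; first by rewrite ger0_norm ?sqr_ge0.
    by rewrite normr0 sqr_ge0.
  (* Measurability of [zeta] is known on the interface, so the restriction is to [interface_minus],
     which gives the same values there as [Jm]. *)
  have mp : measurable_fun (GI : set (caratheodory_type (@hausdorff2 R)))
      ((fun x => cabs (J x) ^+ 2) \_ (interface_minus W1 W2 zeta)).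
    apply/(measurable_restrict _ mminus mGI).
    exact: (measurable_funS mGI (@subIsetl _ _ _) (measurable_cabs_sqr LJ.1)).
  apply: eq_measurable_fun mp => x /set_mem GIx; rewrite patchE /Jm.
  case: ifPn => [xm|xm]; case: ifPn => // x0.
    by move: xm x0; rewrite inE => -[_ ->].
  by move: xm; rewrite notin_setE => -[].
have [iF1 iF2] := iF.
have iFF := integrable_realZ 2^-1 mGI (integrable_realD mGI iF1 iF2).
have iL4 := integrable_realZ 4^-1 mGI iL.
have iDs := integrable_realZ s mGI iD.
have iJc := integrable_realZ (2 * kappa / delta) mGI iJm.
have iLD := integrable_realB mGI iL4 iDs.
have iLDJ := integrable_realB mGI iLD iJc.
have main : 4^-1 * \int[surf]_(x in GI) (cabs (lam x) * cabs (J x) ^+ 2)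
    - s * \int[surf]_(x in GI) (cabs (D x) ^+ 2)
    - 2 * kappa / delta * \int[surf]_(x in GI) Jm x
    <= 2^-1 * (complex.Re S + complex.Im S).
  have := ae_le_Rintegral mGI iLDJ iFF (filterS (fun x pwx GIx => proj2 (pwx GIx)) pw).
  rewrite (RintegralB mGI iLD iJc) (RintegralB mGI iL4 iDs).
  rewrite (RintegralZl _ mGI iL) (RintegralZl _ mGI iD) (RintegralZl _ mGI iJm).
  rewrite (RintegralZl _ mGI (integrable_realD mGI iF1 iF2)) (RintegralD mGI iF1 iF2).
  by move=> /(_ (ae_surf_filter R)).
have Dh : gamma^-1 * \int[surf]_(x in GI) (h * cabs (D x) ^+ 2) =
    s * \int[surf]_(x in GI) (cabs (D x) ^+ 2).
  by rewrite (RintegralZl _ mGI iD) /s mulrA [gamma^-1 * h]mulrC.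
rewrite JmI in main.
have := ReDIm_le_cabs (a_lam W1 W2 Gio n1 n kappa zeta lam p (dg_conj p)).
rewrite reS imS => le_a.
rewrite /dg_norm_sq -/J -/D -/GI -/P -/G Dh.
apply: (energy_combination G0 P0 _ _ main le_a); first by rewrite mulr_ge0// ltW.
by rewrite -Dh.
Qed.

End Stability.

Theorem theorem3p6 (R : realType)
  (W W1 W2 Gio Gs : set (R3 R)) (n1 n : R3 R -> R3 R)
  (H : set R) (T1 T2 : R -> {fset {fset R3 R}}) (k : nat)
  (kappa delta CI gamma : R) (zeta : R3 R -> R[i])
  (hgeo : split_domain W W1 W2 Gio Gs)
  (hn1 : outward_normal W1 W2 n1)
  (hn : n = n1 \/ n = (fun x => - n1 x))
  (hmesh : mesh_families W1 W2 H T1 T2)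
  (hk : (1 <= k)%N)
  (hkappa : 0 < kappa)
  (hzeta : Linfty surf (interface W1 W2) zeta)
  (hRe : {ae surf, forall x, interface W1 W2 x -> 0 <= complex.Re (zeta x)})
  (hdelta : 0 < delta)
  (hzeta_delta : {ae surf, forall x,
     interface_minus W1 W2 zeta x -> delta <= cabs (zeta x)})
  (hCI : 0 < CI)
  (hinv : forall h, H h -> forall p, Vh k W1 W2 (T1 h) (T2 h) n p ->
     \int[surf]_(x in interface W1 W2) (h * cabs (avg_dn p x) ^+ 2)
       <= CI * grad_sq_norm W1 W2 p)
  (hgamma : 16 * CI <= gamma) :
  forall h, H h -> (h%:E <= max_mesh_size W1 W2 kappa gamma delta zeta)%E ->
  forall p, Vh k W1 W2 (T1 h) (T2 h) n p ->
    let lam := stab_lam kappa gamma h zeta in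
    4^-1 * dg_norm_sq W1 W2 n1 n kappa gamma h lam p
    <= cabs (a_lam W1 W2 Gio n1 n kappa zeta lam p (dg_conj p))
       + 2 * kappa * (kappa * sq_norm W1 W2 p
           + delta^-1 * \int[surf]_(x in interface_minus W1 W2 zeta)
                          (cabs (jump n1 n p x) ^+ 2)).
Proof.
move=> h Hh hh p Vp.
have gamma0 : 0 < gamma by apply: lt_le_trans hgamma; rewrite mulr_gt0.
have [h0 hT1 hT2 _] := hmesh.1 _ Hh.
apply: (stability_of_inverse_inequality hgeo hn1 hn hT1 hT2 hkappa hzeta hRe
  hdelta hzeta_delta gamma0 h0 hh Vp.2).
(* After clearing [gamma], 16 times the interface integral is at most [16 CI] times the gradient
   term by the inverse inequality, and [16 CI <= gamma] finishes. *)
rewrite mulrCA ler_pdivrMl//.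
apply: le_trans (_ : 16 * (CI * grad_sq_norm W1 W2 p) <= _).
  by rewrite ler_pM2l//; exact: hinv.
rewrite mulrA ler_wpM2r//.
by apply: Rintegral_ge0 => x _; apply: sumr_ge0 => j _; exact: sqr_ge0.
Qed.
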